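(* Let $Y$ be a positive integrable real random variable and, for each $k\ge1$, let $X_k$ be a $\Gamma(k,1)$-distributed random variable independent of $Y$. Set $Z_k=Y/X_k$ for $k\ge1$. Then the sequence $(Z_k)_{k\ge1}$ verifies gNB, that is: there exist real coefficients $(c_{k,n})_{1\le k\le n,\ n\ge1}$ such that $$\int_0^\infty\left|\chi(t)-\sum_{k=1}^n c_{k,n}\,h_k^\times(t)\right|^2dt\longrightarrow 0\quad\text{as } n\to\infty,\qquad\text{where } h_k^\times(t)=\mathbb{E}\left\{\frac{Z_k}{t}\right\}=\mathbb{E}\left\{\frac{Y}{X_k t}\right\}.$$
   Context: $\{y\}$ denotes the fractional part of a real number $y$, $\mathbb{E}$ the expectation (so $\mathbb{E}\{Z/t\}$ is the expectation of the fractional part of $Z/t$), and $\chi$ the indicator function of the interval $(0,1)$ on $(0,\infty)$. The $\Gamma(k,1)$ distribution is the probability distribution on $(0,\infty)$ with density $f_k(x)=\frac{1}{\Gamma(k)}x^{k-1}e^{-x}$. *)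

(* Defs.v *)
From HB Require Import structures.
From mathcomp Require Import all_boot all_order all_algebra.
From mathcomp Require Import all_classical all_reals all_analysis.
Set Implicit Arguments.
Unset Strict Implicit.
Unset Printing Implicit Defensive.
Import Order.TTheory GRing.Theory Num.Theory.
Import numFieldNormedType.Exports.
Local Open Scope classical_set_scope.
Local Open Scope ring_scope.

Definition frac_part (R : realType) (y : R) : R := y - (Num.floor y)%:~R.

Definition Gamma_fun (R : realType) (s : R) : R :=
  Rintegral lebesgue_measure `]0, +oo[ (fun x : R => x `^ (s - 1) * expR (- x)).

(* Only meant for 1 <= k, where x ^+ k.-1 is x^(k-1). *)
Definition gamma_pdf (R : realType) (k : nat) : R -> R :=
  (fun x => (Gamma_fun (k%:R : R))^-1 * x ^+ k.-1 * expR (- x)) \_ `]0, +oo[.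

Definition gamma_distributed (d : measure_display) (T : measurableType d)
    (R : realType) (P : probability T R) (k : nat) (X : {RV P >-> R}) : Prop :=
  forall A : set R, measurable A ->
    distribution P X A = (\int[lebesgue_measure]_(x in A) (gamma_pdf k x)%:E)%E.

Definition independent_RVs (d : measure_display) (T : measurableType d)
    (R : realType) (P : probability T R) (X Y : {RV P >-> R}) : Prop :=
  forall A B : set R, measurable A -> measurable B ->
    P (X @^-1` A `&` Y @^-1` B) = (P (X @^-1` A) * P (Y @^-1` B))%E.

(* The expectation is finite for measurable Z, as frac_part takes its values
   in [0, 1[, so that fine loses nothing. *)
Definition hmul (d : measure_display) (T : measurableType d) (R : realType)
    (P : probability T R) (Z : T -> R) (t : R) : R :=
  fine ('E_P[fun w => frac_part (Z w / t)]).

(* The sequence is (Z k) for 1 <= k; Z 0 is ignored. The integral is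
   extended-real valued, so convergence to 0 includes its finiteness for all
   large n. *)
Definition gNB (d : measure_display) (T : measurableType d) (R : realType)
    (P : probability T R) (Z : nat -> T -> R) : Prop :=
  exists c : nat -> nat -> R,
    (fun n : nat => (\int[lebesgue_measure]_(t in `]0%R, +oo[)
       (`| \1_(`]0, 1[ : set R) t
           - \sum_(1 <= k < n.+1) c k n * hmul P (Z k) t | ^+ 2)%:E)%E)
      @ \oo --> (0 : \bar R)%E.

(* Main.v *)
From HB Require Import structures.
Require Import Defs.
From mathcomp Require Import all_boot all_order all_algebra.
From mathcomp Require Import all_classical all_reals all_analysis.
From mathcomp Require Import measurable_realfun ring lra.
Import Order.TTheory GRing.Theory Num.Theory.
Import numFieldNormedType.Exports.
Local Open Scope classical_set_scope.
Local Open Scope ring_scope.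

(** Write phi(s) = E{Y/s}.  Conditioning on X_k = x turns E{Y/(X_k t)} into the mixture of the
dilates phi(x t) against the density of the Gamma(k, 1) law.  In the coordinate t = e^u, and after
the isometry F |-> e^(u/2) F(e^u) from L^2(0, +oo) onto L^2(R), this mixture becomes a nonzero
multiple of the correlation
  (corr g_j Phi)(u) = int g_j(v) Phi(v + u) dv,   j = k - 1,
with Phi(u) = e^(u/2) phi(e^u) and g_j(v) = e^((j + 1/2) v) e^(-e^v), and the indicator of (0, 1)
becomes the target e^(u/2) on u <= 0 (lemma hmul_corr).  The bounds phi <= 1 and phi(s) <= E(Y)/s
give |Phi(u)| <= C e^(-|u|/2), and Phi is nonnegative with positive integral.  Only these
properties of Phi are used afterwards; the target then has to be approximated in L^2 by
linear combinations of the functions corr g_j Phi (lemma target_approximation).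

The span of the g_j is rich.  With x = e^v it consists of the functions p(x) x^(1/2) e^(-x), p a
polynomial.  Expanding e^(-q x) around e^(-p x) in powers of x converges in L^1 as long as
0 < q < 2 p, and repeating this reaches every rate q > 0; therefore each convolution f * g_0 with
f integrable is a limit in L^1 of the span (lemma approximable_convol).  By Young's inequality it
is enough to approximate the target by corr (f * g_0) Phi = corr f H, where H = corr g_0 Phi and
f is an arbitrary integrable function.

Since all translates of H are available in this way, one is in the situation of Wiener's theorem
on translates in L^2: it suffices that the Fourier transform of H vanishes almost nowhere.  The
approximation is produced by Landweber's iteration.  The operator A f = corr f H is symmetric, and
the residuals r' = r - kappa A (A r), started at the target, differ from the target by elements of
the range of A, while their Fourier transforms are multiplied at each step by the factor
1 - kappa |H^|^2, which lies between 0 and 1.  A Plancherel inequality bounds the L^2 norms of the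
residuals by the integral of the squared moduli of these transforms, and this tends to 0 by dominated
convergence where H^ does not vanish (lemmas plancherel_le and landweber).

Finally H decays exponentially and its integral is not 0, so H^ is real analytic and does not
vanish identically, and its zeros are countably many (lemma spectrum_neq0_ae).  Unlike in the
criterion of Nyman and Beurling, dilations by all positive factors are available here, and the
transform, which is essentially zeta(s) E(Y^s) Gamma(1 - s) / s, matters only on the line
Re s = 1/2 and up to a null set; this is why the statement holds unconditionally. *)

Set Implicit Arguments.
Unset Strict Implicit.
Unset Printing Implicit Defensive.

(** * Integration against a density *)

Section density.
Context d (T : measurableType d) (R : realType) (mu : {measure set T -> \bar R}).
Variable rho : T -> R.
Hypothesis mrho : measurable_fun setT rho.
Hypothesis rho_ge0 : forall x, 0 <= rho x.

(** The proofs that rho is measurable and nonnegative are arguments of the definition, so that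
    the measure structure below can be recovered from the term alone. *)
Definition density (mrho : measurable_fun setT rho)
    (rho_ge0 : forall x, 0 <= rho x) (A : set T) : \bar R :=
  (\int[mu]_(x in A) (rho x)%:E)%E.

Let density0 : density mrho rho_ge0 set0 = 0%E.
Proof. exact: integral_set0. Qed.

Let density_ge0 A : (0 <= density mrho rho_ge0 A)%E.
Proof. by apply: integral_ge0 => x _; rewrite lee_fin. Qed.

Let density_sigma_additive : semi_sigma_additive (density mrho rho_ge0).
Proof.
move=> F mF tF mUF; rewrite /density ge0_integral_bigcup//.
- by apply: is_cvg_nneseries => n _ _; exact: density_ge0.
- exact/measurable_EFinP/measurable_funTS.
- by move=> x _; rewrite lee_fin.
Qed.

HB.instance Definition _ := isMeasure.Build _ _ _ (density mrho rho_ge0)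
  density0 density_ge0 density_sigma_additive.

End density.

Section density_integral.
Context d (T : measurableType d) (R : realType).
Variables mu nu : {measure set T -> \bar R}.
Import HBNNSimple.

Variable rho : T -> R.
Hypothesis mrho : measurable_fun setT rho.
Hypothesis rho_ge0 : forall x, 0 <= rho x.
Hypothesis nuE : forall A, measurable A -> nu A = (\int[mu]_(x in A) (rho x)%:E)%E.

Let integral_density_nnsfun (h : {nnsfun T >-> R}) :
  (\int[nu]_x (h x)%:E = \int[mu]_x ((h x)%:E * (rho x)%:E))%E.
Proof.
rewrite integralT_nnsfun sintegralE.
transitivity (\int[mu]_x \sum_(r \in range h)
    ((r * \1_(h @^-1` [set r]) x)%:E * (rho x)%:E))%E; last first.
  by apply: eq_integral => x _; rewrite fimfunE -fsumEFin// ge0_mule_fsuml// => r;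
    exact: nnfun_muleindic_ge0.
rewrite ge0_integral_fsum//; first last.
- move=> r x _; apply: mule_ge0; last by rewrite lee_fin.
  exact: nnfun_muleindic_ge0.
- move=> r; apply: emeasurable_funM; apply/measurable_EFinP => //.
  exact: measurable_funM.
apply: eq_fsbigr => r /set_mem[x0 _ x0r].
have r0 : 0 <= r by rewrite -x0r.
rewrite nuE// integral_mkcond.
rewrite -ge0_integralZl//.
- apply: eq_integral => x _; rewrite patchE indicE EFinM -muleA.
  by case: ifPn; rewrite ?mul1e ?mul0e.
- exact/(measurable_restrictT _ _).1/measurable_funTS/measurable_EFinP.
- by move=> x _; rewrite patchE; case: ifPn; rewrite ?lee_fin.
Qed.

(** The formula assumed for measurable sets extends to simple functions by linearity and then to
    nonnegative functions by monotone convergence. *)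
Lemma ge0_integral_density (f : T -> \bar R) :
  measurable_fun setT f -> (forall x, 0 <= f x)%E ->
  (\int[nu]_x f x = \int[mu]_x (f x * (rho x)%:E))%E.
Proof.
move=> mf f0; pose h := nnsfun_approx measurableT mf.
have hf x : (h n x)%:E @[n --> \oo] --> f x by exact: cvg_nnsfun_approx.
have h_nd x : {homo (fun n => (h n x)%:E) : m n / (m <= n)%N >-> (m <= n)%E}.
  by move=> m n mn; rewrite lee_fin; exact/lefP/nd_nnsfun_approx.
have mh n : measurable_fun setT (fun x => (h n x)%:E) by exact/measurable_EFinP.
transitivity (limn (fun n => \int[nu]_x (h n x)%:E))%E.
  rewrite -monotone_convergence//.
  - by apply: eq_integral => x _; apply/esym/cvg_lim.
  - by move=> n x _; rewrite lee_fin.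
under eq_fun do rewrite integral_density_nnsfun.
rewrite -monotone_convergence//.
- apply: eq_integral => x _; apply/cvg_lim => //.
  by apply: cvgeZr.
- by move=> n; apply: emeasurable_funM => //; exact/measurable_EFinP.
- by move=> n x _; rewrite mule_ge0 ?lee_fin.
- by move=> x _ m n mn; rewrite lee_wpmul2r ?lee_fin//; have := h_nd x m n mn; rewrite lee_fin.
Qed.

End density_integral.

(** * Translations, dilations and the exponential substitution *)

Section change_of_variables.
Context {R : realType}.
Notation mu := (@lebesgue_measure R).

Lemma lebesgue_measure_shift (a : R) (A : set R) : measurable A ->
  pushforward mu (fun x => x + a : measurableTypeR R) A = mu A.
Proof.
move=> mA; apply/esym/lebesgue_measure_unique => //=; first exact: measurable_funD.
move=> ma _ [[b c]] _ <-.
rewrite /pushforward/=.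
have -> : (fun x => x + a : measurableTypeR R) @^-1` `]b, c] = `]b - a, c - a]%classic.
  by apply/seteqP; split => x /=; rewrite !in_itv/= ltrBlDr lerBrDr.
rewrite !lebesgue_measure_itv/= !lte_fin ltrD2r.
by case: ifPn => // _; congr (_%:E); ring.
Qed.

Lemma lebesgue_measure_scale (a : R) (A : set R) : 0 < a -> measurable A ->
  (a%:E * pushforward mu (fun x => (a * x)%R : measurableTypeR R) A)%E = mu A.
Proof.
move=> a0 mA.
pose nu := mscale (NngNum (ltW a0)) (pushforward mu (fun x => a * x : measurableTypeR R)).
have ma : measurable_fun setT (fun x : R => a * x : measurableTypeR R).
  exact: mulrl_measurable.
apply/esym; rewrite -[RHS]/(nu ma A); apply: lebesgue_measure_unique => //= _ [[b c]] _ <-.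
rewrite /nu /mscale /pushforward/=.
rewrite -[pushforward _ _ _]/(mu (( *%R a) @^-1` `]b, c])) (_ : _ @^-1` _ = `]b / a, c / a]%classic); last first.
  by apply/seteqP; split => x /=; rewrite !in_itv/= ltr_pdivrMr// ler_pdivlMr// (mulrC x).
rewrite !lebesgue_measure_itv/= !lte_fin ltr_pM2r ?invr_gt0//.
case: ifPn => // _; last by rewrite mule0.
by rewrite -EFinB -!EFinM -mulrBl mulrCA divff ?mulr1 ?gt_eqF.
Qed.

Lemma ge0_integral_shift (a : R) (f : R -> \bar R) :
  measurable_fun setT f -> (forall x, 0 <= f x)%E ->
  (\int[mu]_x f (x + a)%R = \int[mu]_x f x)%E.
Proof.
move=> mf f0.
have ma : measurable_fun setT (fun x : R => x + a : measurableTypeR R).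
  exact: measurable_funD.
transitivity (\int[pushforward mu (fun x => (x + a)%R : measurableTypeR R)]_x f x)%E.
  by rewrite ge0_integral_pushforward.
by apply: eq_measure_integral => A mA _; exact: lebesgue_measure_shift.
Qed.

Lemma ge0_integral_scale (a : R) (f : R -> \bar R) : 0 < a ->
  measurable_fun setT f -> (forall x, 0 <= f x)%E ->
  (a%:E * \int[mu]_x f (a * x)%R = \int[mu]_x f x)%E.
Proof.
move=> a0 mf f0.
have ma : measurable_fun setT (fun x : R => a * x : measurableTypeR R).
  exact: mulrl_measurable.
pose nu := mscale (NngNum (ltW a0)) (pushforward mu (fun x => a * x : measurableTypeR R)).
transitivity (\int[nu ma]_x f x)%E.
  by rewrite ge0_integral_mscale//= ge0_integral_pushforward.
by apply: eq_measure_integral => A mA _; exact: lebesgue_measure_scale.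
Qed.

End change_of_variables.

Section exponential_substitution.
Context {R : realType}.
Notation mu := (@lebesgue_measure R).

Let invpos : R -> R := (fun t : R => t^-1 : R) \_ `]0, +oo[.

Let invpos_ge0 t : 0 <= invpos t.
Proof.
rewrite /invpos patchE; case: ifPn => //; rewrite inE/= in_itv/= andbT => t0.
by rewrite invr_ge0 ltW.
Qed.

Let measurable_invpos : measurable_fun setT invpos.
Proof.
apply/(measurable_restrictT _ _).1 => //.
apply: open_continuous_measurable_fun => // t.
by rewrite inE/= in_itv/= andbT => t0; apply: inv_continuous; rewrite gt_eqF.
Qed.

Let nu : {measure set (measurableTypeR R) -> \bar R} := density mu measurable_invpos invpos_ge0.

(** By the fundamental theorem of calculus, 1 / t has integral c - b between e^b and e^c, and
    the measures of the intervals determine Lebesgue measure. *)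
Let pushforward_ln (A : set R) : measurable A ->
  pushforward nu (@ln R : R -> measurableTypeR R) A = mu A.
Proof.
move=> mA; apply/esym/lebesgue_measure_unique => //=.
move=> _ [[b c]] _ <-.
rewrite /pushforward /density.
transitivity (\int[mu]_(x in @ln R @^-1` `]b, c])
    ((EFin \o (fun t : R => t^-1%R)) \_ `]0%R, +oo[) x)%E; last first.
  by apply: eq_integral => t _; rewrite restrict_EFin.
rewrite -integral_mkcondr.
rewrite (_ : _ `&` _ = `]expR b, expR c]%classic); last first.
  apply/seteqP; split => t /=; rewrite !in_itv/= andbT.
    by move=> [/andP[bt tc] t0]; rewrite -[t]lnK// ltr_expR ler_expR bt.
  move=> /andP[bt tc]; have t0 : 0 < t by rewrite (lt_trans _ bt)// expR_gt0.
  by split => //; rewrite -ltr_expR -ler_expR lnK// bt.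
rewrite lebesgue_measure_itv/= lte_fin; case: ifPn => bc; last first.
  by rewrite set_itv_ge ?integral_set0//= bnd_simp ltr_expR.
have cinv x : expR b <= x -> {for x, continuous (fun t : R => t^-1)}.
  move=> bx; apply: inv_continuous; rewrite gt_eqF// (lt_le_trans _ bx)//.
  exact: expR_gt0.
have cinvI : {within `[expR b, expR c], continuous (fun t : R => t^-1)}.
  apply: continuous_in_subspaceT => x; rewrite inE/= in_itv/= => /andP[bx _].
  exact: cinv.
rewrite integral_itv_obnd_cbnd; last first.
  apply/measurable_EFinP; apply: (@measurable_funS _ _ _ _ `[expR b, expR c]%classic) => //.
    by apply: subset_itvr; rewrite bnd_simp.
  exact: (subspace_continuous_measurable_fun _ cinvI).
rewrite (@continuous_FTC2 _ _ (@ln R)) ?ltr_expR//.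
- by rewrite !expRK.
- split.
  + move=> x; rewrite in_itv/= => /andP[bx _].
    by apply: ex_derive; apply: is_derive1_ln; rewrite (lt_trans _ bx)// expR_gt0.
  + by apply: cvg_at_right_filter; apply: continuous_ln; exact: expR_gt0.
  + by apply: cvg_at_left_filter; apply: continuous_ln; exact: expR_gt0.
- move=> x; rewrite in_itv/= => /andP[bx _]; rewrite derive1E.
  by apply: derive_val; apply: is_derive1_ln; rewrite (lt_trans _ bx)// expR_gt0.
Qed.

(** The integrand is only assumed to be measurable, because an expected fractional part need not
    depend continuously on its argument. *)
Lemma ge0_integral_expR (f : R -> \bar R) :
  measurable_fun setT f -> (forall x, 0 <= f x)%E ->
  (\int[mu]_(t in `]0%R, +oo[) f t = \int[mu]_u (f (expR u) * (expR u)%:E))%E.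
Proof.
move=> mf f0; pose g u := (f (expR u) * (expR u)%:E)%E.
have mexp : measurable_fun setT (@expR R) by exact: measurable_expR.
have g0 u : (0 <= g u)%E by rewrite mule_ge0// lee_fin expR_ge0.
have mg : measurable_fun setT g.
  apply: emeasurable_funM; first exact: measurableT_comp.
  exact/measurable_EFinP.
have mln : measurable_fun setT (@ln R : R -> measurableTypeR R).
  exact: measurable_ln.
transitivity (\int[pushforward nu (@ln R : R -> measurableTypeR R)]_u g u)%E;
    last first.
  by apply: eq_measure_integral => A mA _; exact: pushforward_ln.
rewrite ge0_integral_pushforward//= preimage_setT.
apply/esym; transitivity (\int[mu]_t (g (ln t) * (invpos t)%:E))%E.
  apply: (@ge0_integral_density _ (measurableTypeR R) R mu nu invpos measurable_invpos _ _
    (fun t => g (ln t))) => //.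
  exact: measurableT_comp.
rewrite [RHS]integral_mkcond; apply: eq_integral => t _ /=.
rewrite /invpos !patchE; case: ifPn => [|_]; last by rewrite ?mule0.
rewrite inE/= in_itv/= andbT => t0.
by rewrite /g lnK// -muleA -EFinM mulfV ?mule1// gt_eqF.
Qed.

End exponential_substitution.

(** * Real-valued integrals, Fubini's theorem, correlation and convolution *)

Section integrable_functions.
Context d (T : measurableType d) {R : realType} (mu : {measure set T -> \bar R}).
Notation L1 f := (mu.-integrable setT (EFin \o f)).
Implicit Types f g : T -> R.

Lemma L1_measurable f : L1 f -> measurable_fun setT f.
Proof. by move=> /(measurable_int mu)/measurable_EFinP. Qed.

Lemma L1_le f g : measurable_fun setT f -> (forall x, `|f x| <= g x) ->
  L1 g -> L1 f.
Proof.
move=> mf fg; apply: le_integrable => //; first exact/measurable_EFinP.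
by move=> x _ /=; rewrite lee_fin (le_trans (fg x))// ler_norm.
Qed.

Lemma L1_mulr f g (M : R) : L1 f -> measurable_fun setT g ->
  (forall x, `|g x| <= M) -> L1 (fun x => f x * g x).
Proof.
move=> if_ mg gM; apply: (@L1_le _ (fun x => M * `|f x|)).
- by apply: measurable_funM => //; exact: L1_measurable.
- by move=> x; rewrite normrM mulrC ler_wpM2r.
- exact: (integrableZl measurableT M (integrable_norm if_)).
Qed.

Lemma L1_scale c f : L1 f -> L1 (fun x => c * f x).
Proof. exact: integrableZl. Qed.

Lemma L1_add f g : L1 f -> L1 g -> L1 (fun x => f x + g x).
Proof. exact: integrableD. Qed.

Lemma L1_sub f g : L1 f -> L1 g -> L1 (fun x => f x - g x).
Proof. exact: integrableB. Qed.

Lemma L1_EFin_Rintegral f : L1 f -> (\int[mu]_x (f x)%:E)%E = (\int[mu]_x f x)%:E.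
Proof. by move=> if_; rewrite /Rintegral fineK//; exact: integrable_fin_num. Qed.

Lemma le_norm_Rintegral f g : L1 f -> L1 g -> (forall x, `|f x| <= g x) ->
  `|\int[mu]_x f x| <= \int[mu]_x g x.
Proof.
move=> if_ ig fg; apply: le_trans (le_normr_Rintegral measurableT if_) _.
by apply: le_Rintegral => //; exact: (integrable_norm if_).
Qed.

End integrable_functions.

Section fubini_real.
Context d1 d2 (T1 : measurableType d1) (T2 : measurableType d2) {R : realType}.
Variables (m1 : {sigma_finite_measure set T1 -> \bar R}).
Variables (m2 : {sigma_finite_measure set T2 -> \bar R}).

Variables (F : T1 -> T2 -> R) (b : T1 -> R).
Hypothesis mF : measurable_fun setT (fun z : T1 * T2 => F z.1 z.2).
Hypothesis iF1 : forall x, m2.-integrable setT (EFin \o F x).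
Hypothesis iF2 : forall y, m1.-integrable setT (EFin \o F^~ y).
Hypothesis Fb : forall x, \int[m2]_y `|F x y| <= b x.
Hypothesis ib : m1.-integrable setT (EFin \o b).

(** Integrability is asked for on every line in each direction, rather than on almost every one:
    the real-valued inner integrals, which are 0 when undefined, then agree everywhere with the
    extended ones. *)
Lemma integrable_Rfubini :
  (m1 \x m2)%E.-integrable setT (EFin \o (fun z => F z.1 z.2)).
Proof.
apply/integrable12ltyP; first exact/measurable_EFinP.
have ib' := integrable_norm ib.
apply: le_lt_trans (integrable_lty measurableT ib').
have mF' : measurable_fun setT (fun z => `|F z.1 z.2|%:E).
  by apply/measurable_EFinP/measurableT_comp.
apply: ge0_le_integral => //=.
- by move=> x _; apply: integral_ge0.
- exact: (measurable_fun_fubini_tonelli_F _ mF').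
- exact: measurable_int ib'.
move=> x _; rewrite (L1_EFin_Rintegral (integrable_norm (iF1 x))) lee_fin.
by rewrite (le_trans (Fb x))// ler_norm.
Qed.

Lemma integrable_Rfubini2 : m2.-integrable setT (EFin \o (fun y => \int[m1]_x F x y)).
Proof.
apply/integrableP; split.
  have := measurable_fubini_G integrable_Rfubini.
  by apply: eq_measurable_fun => y _; rewrite /fubini_G/= L1_EFin_Rintegral.
have mF' : measurable_fun setT (fun z => `|F z.1 z.2|%:E).
  by apply/measurable_EFinP/measurableT_comp.
have := integrable_Rfubini => /[dup] /(measurable_int _) mE /(integrable21ltyP _ _ mE).
apply: le_lt_trans; apply: ge0_le_integral => //=.
- apply/measurable_EFinP/measurableT_comp => //.
  apply/measurable_EFinP; have := measurable_fubini_G integrable_Rfubini.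
  by apply: eq_measurable_fun => y _; rewrite /fubini_G/= L1_EFin_Rintegral.
- exact: (measurable_fun_fubini_tonelli_G _ mF').
move=> y _; rewrite (L1_EFin_Rintegral (integrable_norm (iF2 y))) lee_fin.
exact: le_normr_Rintegral.
Qed.

Lemma Rfubini : \int[m1]_x \int[m2]_y F x y = \int[m2]_y \int[m1]_x F x y.
Proof.
rewrite /Rintegral; congr fine.
under eq_integral do rewrite -L1_EFin_Rintegral//.
under [RHS]eq_integral do rewrite -L1_EFin_Rintegral//.
exact: (Fubini integrable_Rfubini).
Qed.

End fubini_real.

Section correlation.
Context {R : realType}.
Notation mu := (@lebesgue_measure R).
Notation L1 f := (mu.-integrable setT (EFin \o f)).
Implicit Types f g w h : R -> R.

Lemma Rintegral_shift f (a : R) : measurable_fun setT f ->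
  \int[mu]_x f (x + a) = \int[mu]_x f x.
Proof.
move=> mf; rewrite /Rintegral; congr fine; rewrite integralE [RHS]integralE.
have mf' : measurable_fun setT (EFin \o f) by exact/measurable_EFinP.
congr (_ - _)%E.
- rewrite -[RHS](ge0_integral_shift a (measurable_funepos mf') (fun=> funepos_ge0 _ _)).
  by apply: eq_integral => x _; rewrite funepos.unlock.
- rewrite -[RHS](ge0_integral_shift a (measurable_funeneg mf') (fun=> funeneg_ge0 _ _)).
  by apply: eq_integral => x _; rewrite funeneg.unlock.
Qed.

Lemma L1_shift f (a : R) : L1 f -> L1 (fun x => f (x + a)).
Proof.
move=> /[dup] /L1_measurable mf /integrableP[_ fy]; apply/integrableP; split.
  by apply/measurable_EFinP; apply: measurableT_comp => //; exact: measurable_funD.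
rewrite -(ge0_integral_shift a) in fy => //.
by apply: measurableT_comp => //; exact/measurable_EFinP.
Qed.

(** Common source of the pairing formulas for correlations and convolutions: one may test the
    mixture of the functions [k x] against [w], or mix the values of the individual tests. *)
Lemma kernel_pairing f (k : R -> R -> R) w (K M W : R) :
  L1 f -> measurable_fun setT (fun z : R * R => k z.1 z.2) ->
  (forall x, L1 (k x)) -> (forall x, \int[mu]_v `|k x v| <= K) ->
  (forall x v, `|k x v| <= M) ->
  measurable_fun setT w -> (forall v, `|w v| <= W) ->
  L1 (fun v => (\int[mu]_x (f x * k x v)) * w v) /\
  \int[mu]_v ((\int[mu]_x (f x * k x v)) * w v) =
  \int[mu]_x (f x * \int[mu]_v (k x v * w v)).
Proof.
move=> if_ mk ik kK kM mw wW.
have mkr v : measurable_fun setT (fun x => k x v).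
  exact: (measurableT_comp mk (measurable_pair2 v)).
have ikw x : L1 (fun v => k x v * w v) by apply: L1_mulr (ik x) mw wW.
pose F x v := f x * (k x v * w v).
have mF : measurable_fun setT (fun z : R * R => F z.1 z.2).
  apply: measurable_funM.
    by apply: measurableT_comp (@measurable_fst _ _ _ _) => //; exact: L1_measurable if_.
  apply: measurable_funM => //.
  exact: (measurableT_comp mw (@measurable_snd _ _ _ _)).
have iF1 x : L1 (F x) by exact: L1_scale.
have iF2 v : L1 (F^~ v).
  apply: (@L1_mulr _ _ _ _ _ _ (M * W)) => //.
    by apply: measurable_funM; [exact: mkr|exact: measurable_cst].
  by move=> x; rewrite normrM ler_pM.
pose b x := (K * W) * `|f x|.
have ib : L1 b by apply: L1_scale; exact: (integrable_norm if_).
have Fb x : \int[mu]_v `|F x v| <= b x.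
  rewrite (_ : b x = `|f x| * (K * W)); last by rewrite /b mulrC.
  under eq_Rintegral do rewrite normrM.
  rewrite RintegralZl//; last exact: (integrable_norm (ikw x)).
  apply: ler_wpM2l => //; have W0 : 0 <= W by exact: le_trans (wW 0).
  apply: le_trans (ler_wpM2r W0 (kK x)).
  rewrite -RintegralZr//; last exact: (integrable_norm (ik x)).
  apply: le_Rintegral => //.
  - exact: (integrable_norm (ikw x)).
  - exact: (integrableZr measurableT W (integrable_norm (ik x))).
  - by move=> v _; rewrite normrM ler_wpM2l.
have FE v : \int[mu]_x F x v = (\int[mu]_x (f x * k x v)) * w v.
  rewrite -RintegralZr//; first by apply: eq_Rintegral => x _; rewrite /F mulrA.
  by apply: (@L1_mulr _ _ _ _ _ _ M) => // ; exact: mkr.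
split.
  have := @integrable_Rfubini2 _ _ (measurableTypeR R) (measurableTypeR R) R mu mu F b mF iF1 iF2 Fb ib.
  by apply: eq_integrable => // v _; rewrite /= FE.
under eq_Rintegral do rewrite -FE.
rewrite -(@Rfubini _ _ (measurableTypeR R) (measurableTypeR R) R mu mu F b mF iF1 iF2 Fb ib).
by apply: eq_Rintegral => x _; rewrite RintegralZl.
Qed.

(** Correlation, rather than convolution, is the basic operation because [f |-> corr f g] has the
    symmetric kernel g(x + v). *)
Definition corr f g (v : R) : R := \int[mu]_x (f x * g (x + v)).
Definition convol f g (v : R) : R := \int[mu]_x (f x * g (v - x)).

Section corr_theory.
Variables (f g : R -> R) (M : R).
Hypotheses (if_ : L1 f) (ig : L1 g) (gM : forall x, `|g x| <= M).

Let mf : measurable_fun setT f := L1_measurable if_.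
Let mg : measurable_fun setT g := L1_measurable ig.

Lemma corr_L1r v : L1 (fun x => f x * g (x + v)).
Proof.
apply: (@L1_mulr _ _ _ _ _ _ M) => //.
by apply: measurableT_comp => //; exact: measurable_funD.
Qed.

Lemma corr_le v : `|corr f g v| <= M * \int[mu]_x `|f x|.
Proof.
rewrite -RintegralZl//; last exact: integrable_norm.
apply: le_norm_Rintegral; first exact: corr_L1r.
- by apply: L1_scale; exact: integrable_norm.
- by move=> x; rewrite normrM mulrC ler_wpM2r.
Qed.

Lemma corr_pairing w (W : R) : measurable_fun setT w -> (forall v, `|w v| <= W) ->
  L1 (fun v => corr f g v * w v) /\
  \int[mu]_v (corr f g v * w v) = \int[mu]_x (f x * \int[mu]_y (g y * w (y - x))).
Proof.
move=> mw wW.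
have mgx x : measurable_fun setT (fun v : R => g (x + v)).
  by apply: measurableT_comp => //; exact: measurable_funD.
have igx x : L1 (fun v : R => g (x + v)).
  have := L1_shift x ig; apply: eq_integrable => // v _ /=.
  by rewrite addrC.
have mk : measurable_fun setT (fun z : R * R => g (z.1 + z.2)).
  by apply: measurableT_comp => //; exact: measurable_funD.
have kK x : \int[mu]_v `|g (x + v)| <= \int[mu]_y `|g y|.
  rewrite -[leRHS](Rintegral_shift x); last exact: measurableT_comp.
  by rewrite le_eqVlt; apply/orP; left; apply/eqP/eq_Rintegral => v _; rewrite addrC.
have [iw ->] := @kernel_pairing f (fun x v : R => g (x + v)) w
  (\int[mu]_y `|g y|) M W if_ mk igx kK (fun x v => gM _) mw wW.
split => //; apply: eq_Rintegral => x _; congr (_ * _).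
rewrite -[RHS](Rintegral_shift x).
  by apply: eq_Rintegral => v _; rewrite addrK addrC.
apply: measurable_funM => //; apply: measurableT_comp => //.
exact: measurable_funB.
Qed.

Lemma corr_L1 : L1 (corr f g).
Proof.
have [] := @corr_pairing (cst 1) 1; [by []|by move=> v; rewrite normr1|].
by move=> + _; apply: eq_integrable => // v _ /=; rewrite mulr1.
Qed.

Lemma convol_pairing w (W : R) : measurable_fun setT w -> (forall v, `|w v| <= W) ->
  L1 (fun v => convol f g v * w v) /\
  \int[mu]_v (convol f g v * w v) = \int[mu]_x (f x * \int[mu]_y (g y * w (y + x))).
Proof.
move=> mw wW.
have igx x : L1 (fun v : R => g (v - x)) by exact: (L1_shift (- x) ig).
have mk : measurable_fun setT (fun z : R * R => g (z.2 - z.1)).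
  by apply: measurableT_comp => //; exact: measurable_funB.
have kK x : \int[mu]_v `|g (v - x)| <= \int[mu]_y `|g y|.
  by rewrite -[leRHS](Rintegral_shift (- x)) //; exact: measurableT_comp.
have [iw ->] := @kernel_pairing f (fun x v : R => g (v - x)) w
  (\int[mu]_y `|g y|) M W if_ mk igx kK (fun x v => gM _) mw wW.
split => //; apply: eq_Rintegral => x _; congr (_ * _).
rewrite -[RHS](Rintegral_shift (- x)).
  by apply: eq_Rintegral => v _; rewrite subrK.
apply: measurable_funM => //; apply: measurableT_comp => //.
exact: measurable_funD.
Qed.

Lemma convol_L1 : L1 (convol f g).
Proof.
have [] := @convol_pairing (cst 1) 1; [by []|by move=> v; rewrite normr1|].
by move=> + _; apply: eq_integrable => // v _ /=; rewrite mulr1.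
Qed.

(** Both sides integrate f(x) g(y) h(x + y + u) over the plane. *)
Lemma corr_corr h (H u : R) : measurable_fun setT h -> (forall x, `|h x| <= H) ->
  corr f (corr g h) u = corr (convol f g) h u.
Proof.
move=> mh hH; rewrite /corr.
have mhu : measurable_fun setT (fun x : R => h (x + u)).
  by apply: measurableT_comp => //; exact: measurable_funD.
have [_ ->] := @convol_pairing (fun x : R => h (x + u)) H
  mhu
  (fun v => hH _).
apply: eq_Rintegral => x _; congr (_ * _).
by apply: eq_Rintegral => y _; rewrite addrA.
Qed.

End corr_theory.

End correlation.

(** * Dominated convergence, continuity of correlations and Young's inequality *)

Section limits.
Context d (T : measurableType d) {R : realType} (mu : {measure set T -> \bar R}).
Notation L1 f := (mu.-integrable setT (EFin \o f)).

Lemma Rdominated_cvg (f_ : nat -> T -> R) (f g : T -> R) :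
  (forall n, measurable_fun setT (f_ n)) -> measurable_fun setT f ->
  {ae mu, forall x, f_ ^~ x @ \oo --> f x} -> L1 g ->
  (forall n x, `|f_ n x| <= g x) ->
  (fun n => \int[mu]_x f_ n x) @ \oo --> \int[mu]_x f x.
Proof.
move=> mf_ mf f_f ig f_g.
have if_ n : L1 (f_ n) by exact: L1_le ig.
have [||||if0 _ +] := @dominated_convergence _ _ _ mu _ measurableT
  (fun n => EFin \o f_ n) (EFin \o f) (EFin \o g) _ _ _ ig.
- by move=> n; exact/measurable_EFinP.
- exact/measurable_EFinP.
- by apply: filterS f_f => x f_fx _; apply: cvg_EFin => //; exact: nearW.
- by apply: aeW => /= x n _; rewrite lee_fin.
- rewrite /= L1_EFin_Rintegral// => /fine_cvg; apply: cvg_trans.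
  by apply: near_eq_cvg; near=> n; rewrite /= L1_EFin_Rintegral.
Unshelve. all: by end_near. Qed.

End limits.

Section correlation_limits.
Context {R : realType}.
Notation mu := (@lebesgue_measure R).
Notation L1 f := (mu.-integrable setT (EFin \o f)).
Implicit Types f g w h : R -> R.

Lemma ge0_integral_oppr (F : R -> \bar R) :
  measurable_fun setT F -> (forall x, 0 <= F x)%E ->
  (\int[mu]_x F (- x)%R = \int[mu]_x F x)%E.
Proof.
move=> mF F0.
have mN : measurable_fun setT (fun x : R => - x : measurableTypeR R).
  exact: oppr_measurable.
transitivity (\int[pushforward mu (fun x => - x : measurableTypeR R)%R]_x F x)%E.
  by rewrite ge0_integral_pushforward.
by apply: eq_measure_integral => A mA _; exact: lebesgue_measureN.
Qed.

Lemma Rintegral_oppr f : measurable_fun setT f ->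
  \int[mu]_x f (- x) = \int[mu]_x f x.
Proof.
move=> mf; have mf' : measurable_fun setT (EFin \o f) by exact/measurable_EFinP.
rewrite /Rintegral; congr fine; rewrite integralE [RHS]integralE.
congr (_ - _)%E.
- rewrite -[RHS](ge0_integral_oppr (measurable_funepos mf') (fun=> funepos_ge0 _ _)).
  by apply: eq_integral => x _; rewrite funepos.unlock.
- rewrite -[RHS](ge0_integral_oppr (measurable_funeneg mf') (fun=> funeneg_ge0 _ _)).
  by apply: eq_integral => x _; rewrite funeneg.unlock.
Qed.

Lemma L1_oppr f : L1 f -> L1 (fun x => f (- x)).
Proof.
move=> /[dup] /L1_measurable mf /integrableP[_ fy]; apply/integrableP; split.
  by apply/measurable_EFinP; apply: measurableT_comp => //; exact: oppr_measurable.
rewrite -ge0_integral_oppr in fy => //.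
by apply: measurableT_comp => //; exact/measurable_EFinP.
Qed.

Lemma Rintegral_scale f (a : R) : 0 < a -> L1 f ->
  L1 (fun x => f (a * x)) /\ a * \int[mu]_x f (a * x) = \int[mu]_x f x.
Proof.
move=> a0 if_; have mf := L1_measurable if_.
have mf' : measurable_fun setT (EFin \o f) by exact/measurable_EFinP.
have ifa : L1 (fun x => f (a * x)).
  apply/integrableP; split.
    by apply/measurable_EFinP; apply: measurableT_comp => //; exact: mulrl_measurable.
  have [_] := integrableP _ _ _ if_; rewrite -(ge0_integral_scale a0)//=; last first.
    by apply/measurable_EFinP; exact: measurableT_comp.
  move=> /(@lte_mul_pinfty _ (a^-1)%:E); rewrite lee_fin invr_ge0 (ltW a0).
  by rewrite muleA -EFinM mulVf ?gt_eqF// mul1e; apply.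
split => //; apply: EFin_inj.
rewrite EFinM -!L1_EFin_Rintegral// integralE [RHS]integralE.
rewrite muleBr//; last exact: (integrable_add_def measurableT ifa).
congr (_ - _)%E.
- rewrite -[RHS](ge0_integral_scale a0 (measurable_funepos mf') (fun=> funepos_ge0 _ _)).
  by congr (_ * _)%E; apply: eq_integral => x _; rewrite funepos.unlock.
- rewrite -[RHS](ge0_integral_scale a0 (measurable_funeneg mf') (fun=> funeneg_ge0 _ _)).
  by congr (_ * _)%E; apply: eq_integral => x _; rewrite funeneg.unlock.
Qed.

(** A single discontinuity c of [g] is harmless: for each v it affects only x = c - v, and
    dominated convergence ignores this null set. *)
Lemma corr_continuous f g (M c : R) : L1 f -> measurable_fun setT g ->
  (forall x, `|g x| <= M) -> (forall x, x != c -> {for x, continuous g}) ->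
  continuous (corr f g).
Proof.
move=> if_ mg gM cg v; apply/(@cvg_nbhsP R R^o) => u uv.
have mf := L1_measurable if_.
apply: (@Rdominated_cvg _ _ _ mu _ _ (fun x => M * `|f x|)).
- move=> n; apply: measurable_funM => //; apply: measurableT_comp => //.
  exact: measurable_funD.
- apply: measurable_funM => //; apply: measurableT_comp => //.
  exact: measurable_funD.
- exists [set c - v]; split => //; first exact: lebesgue_measure_set1.
  move=> x /= nx; apply: contrapT => /eqP xc; apply: nx.
  apply: cvgM; first exact: cvg_cst.
  apply: (@cvg_comp _ _ _ (fun n => x + u n) g); last first.
    by apply: cg; apply: contra_neq xc => <-; rewrite addrK.
  by apply: cvgD => //; exact: cvg_cst.
- by apply: L1_scale; exact: (integrable_norm if_).
- by move=> n x; rewrite normrM mulrC ler_wpM2r.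
Qed.

(** Cauchy-Schwarz inequality for the measure |f(x)| dx. *)
Lemma corr_sqr_le f g (M : R) : L1 f -> L1 g -> (forall x, `|g x| <= M) ->
  forall v, corr f g v ^+ 2 <=
    (\int[mu]_x `|f x|) * corr (fun x => `|f x|) (fun x => g x ^+ 2) v.
Proof.
move=> if_ ig gM v; set N := \int[mu]_x _; set a := corr f g v; set B := corr _ _ v.
have inf := integrable_norm if_.
have mg := L1_measurable ig.
have mgv : measurable_fun setT (fun x : R => g (x + v)).
  by apply: measurableT_comp => //; exact: measurable_funD.
have M0 : 0 <= M by exact: le_trans (gM 0).
have iB : L1 (fun x => `|f x| * g (x + v) ^+ 2).
  apply: (@L1_mulr _ _ _ _ _ _ (M ^+ 2)) => //; first exact: measurable_funX.
  by move=> x; rewrite normrX ler_sqr ?nnegrE.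
have ia : L1 (fun x => f x * g (x + v)) by exact: corr_L1r ig gM _.
(* this quadratic in t is the integral of |f x| (t - sgn (f x) g (x + v))^2 *)
have quad t : 0 <= t ^+ 2 * N - 2 * t * a + B.
  have i1 : L1 (fun x => t ^+ 2 * `|f x|) by exact: L1_scale.
  have i2 : L1 (fun x => 2 * t * (f x * g (x + v))) by exact: L1_scale.
  rewrite -!RintegralZl// -RintegralB// -RintegralD//; last exact: L1_sub.
  apply: Rintegral_ge0 => x _.
  rewrite -{2}(mulr_sg_norm (f x)); have := normr_ge0 (f x); move: `|f x| => z z0.
  rewrite (_ : _ + _ = z * ((t - Num.sg (f x) * g (x + v)) ^+ 2 +
      (1 - Num.sg (f x) ^+ 2) * g (x + v) ^+ 2)); last by ring.
  rewrite mulr_ge0// addr_ge0 ?sqr_ge0// mulr_ge0 ?sqr_ge0// subr_ge0 sqr_sg.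
  by case: (_ != _).
have N0 : 0 <= N by apply: Rintegral_ge0.
move: N0; rewrite le_eqVlt => /predU1P[N0|N0].
  rewrite -N0 mul0r; have : `|a| <= M * N by exact: corr_le if_ ig gM v.
  by rewrite -N0 mulr0 normr_le0 => /eqP ->; rewrite expr0n.
(* the minimum of the quadratic *)
have := quad (a / N).
have -> : (a / N) ^+ 2 * N - 2 * (a / N) * a + B = B - a ^+ 2 / N.
  by field; rewrite gt_eqF.
by rewrite subr_ge0 ler_pdivrMr// mulrC.
Qed.

Lemma L1_sqr f (M : R) : L1 f -> (forall x, `|f x| <= M) -> L1 (fun x => f x ^+ 2).
Proof.
move=> if_ fM; apply: eq_integrable (L1_mulr if_ (L1_measurable if_) fM) => //.
Qed.

(** Closeness in L^1 of the first factors thus implies closeness in L^2 of the correlations. *)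
Lemma young_sqr f g (M : R) : L1 f -> L1 g -> (forall x, `|g x| <= M) ->
  \int[mu]_v corr f g v ^+ 2 <= (\int[mu]_x `|f x|) ^+ 2 * \int[mu]_x g x ^+ 2.
Proof.
move=> if_ ig gM.
have inf := integrable_norm if_.
have M0 : 0 <= M by exact: le_trans (gM 0).
have ig2 : L1 (fun x => g x ^+ 2) by exact: L1_sqr gM.
have g2M x : `|g x ^+ 2| <= M ^+ 2 by rewrite normrX ler_sqr ?nnegrE.
have icorr2 := corr_L1 inf ig2 g2M.
have c1 (v : R) : `|(cst 1 : R -> R) v| <= 1 by rewrite normr1.
have [_] := corr_pairing inf ig2 g2M (measurable_cst _) c1.
under eq_Rintegral do rewrite mulr1.
under [RHS]eq_Rintegral do under eq_Rintegral do rewrite mulr1.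
rewrite RintegralZr// => E.
rewrite expr2 -mulrA -E -RintegralZl//.
apply: le_Rintegral => //.
- by apply: L1_sqr (corr_L1 if_ ig gM) (corr_le if_ ig gM).
- exact: L1_scale.
- by move=> v _; exact: corr_sqr_le gM v.
Qed.

End correlation_limits.

(** * Fourier transforms and a Plancherel inequality *)

Section fourier.
Context {R : realType}.
Notation mu := (@lebesgue_measure R).
Notation L1 f := (mu.-integrable setT (EFin \o f)).
Implicit Types f g r : R -> R.

Definition cosT f (t : R) : R := \int[mu]_x (f x * cos (t * x)).
Definition sinT f (t : R) : R := \int[mu]_x (f x * sin (t * x)).

Lemma measurable_cosM (t : R) : measurable_fun setT (fun x : R => cos (t * x)).
Proof.
apply: measurableT_comp; last exact: mulrl_measurable.
exact: continuous_measurable_fun (@continuous_cos R).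
Qed.

Lemma measurable_sinM (t : R) : measurable_fun setT (fun x : R => sin (t * x)).
Proof.
apply: measurableT_comp; last exact: mulrl_measurable.
exact: continuous_measurable_fun (@continuous_sin R).
Qed.

Lemma L1_cos f t : L1 f -> L1 (fun x => f x * cos (t * x)).
Proof.
move=> if_; apply: (@L1_mulr _ _ _ _ _ _ 1) => //; first exact: measurable_cosM.
by move=> x; exact: cos_max.
Qed.

Lemma L1_sin f t : L1 f -> L1 (fun x => f x * sin (t * x)).
Proof.
move=> if_; apply: (@L1_mulr _ _ _ _ _ _ 1) => //; first exact: measurable_sinM.
by move=> x; exact: sin_max.
Qed.

Lemma cosT_le f t : L1 f -> `|cosT f t| <= \int[mu]_x `|f x|.
Proof.
move=> if_; apply: le_norm_Rintegral; [exact: L1_cos|exact: integrable_norm|].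
by move=> x; rewrite normrM ler_piMr// cos_max.
Qed.

Lemma sinT_le f t : L1 f -> `|sinT f t| <= \int[mu]_x `|f x|.
Proof.
move=> if_; apply: le_norm_Rintegral; [exact: L1_sin|exact: integrable_norm|].
by move=> x; rewrite normrM ler_piMr// sin_max.
Qed.

Lemma cosT_continuous f : L1 f -> continuous (cosT f).
Proof.
move=> if_ t; apply/(@cvg_nbhsP R R^o) => u ut; have mf := L1_measurable if_.
apply: (@Rdominated_cvg _ _ _ mu _ _ (fun x => `|f x|)).
- by move=> n; apply: measurable_funM => //; exact: measurable_cosM.
- by apply: measurable_funM => //; exact: measurable_cosM.
- apply: aeW => x; apply: cvgM; first exact: cvg_cst.
  apply: (@cvg_comp _ _ _ (fun n => u n * x) cos); last exact: continuous_cos.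
  by apply: cvgM => //; exact: cvg_cst.
- exact: integrable_norm.
- by move=> n x; rewrite normrM ler_piMr// cos_max.
Qed.

Lemma sinT_continuous f : L1 f -> continuous (sinT f).
Proof.
move=> if_ t; apply/(@cvg_nbhsP R R^o) => u ut; have mf := L1_measurable if_.
apply: (@Rdominated_cvg _ _ _ mu _ _ (fun x => `|f x|)).
- by move=> n; apply: measurable_funM => //; exact: measurable_sinM.
- by apply: measurable_funM => //; exact: measurable_sinM.
- apply: aeW => x; apply: cvgM; first exact: cvg_cst.
  apply: (@cvg_comp _ _ _ (fun n => u n * x) sin); last exact: continuous_sin.
  by apply: cvgM => //; exact: cvg_cst.
- exact: integrable_norm.
- by move=> n x; rewrite normrM ler_piMr// sin_max.
Qed.

Lemma cosTB f g t : L1 f -> L1 g -> cosT (fun x => f x - g x) t = cosT f t - cosT g t.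
Proof.
move=> if_ ig; rewrite /cosT -RintegralB//; [|exact: L1_cos..].
by apply: eq_Rintegral => x _; rewrite mulrBl.
Qed.

Lemma sinTB f g t : L1 f -> L1 g -> sinT (fun x => f x - g x) t = sinT f t - sinT g t.
Proof.
move=> if_ ig; rewrite /sinT -RintegralB//; [|exact: L1_sin..].
by apply: eq_Rintegral => x _; rewrite mulrBl.
Qed.

Lemma cosTZ f k t : L1 f -> cosT (fun x => k * f x) t = k * cosT f t.
Proof.
move=> if_; rewrite /cosT -RintegralZl//; last exact: L1_cos.
by apply: eq_Rintegral => x _; rewrite mulrA.
Qed.

Lemma sinTZ f k t : L1 f -> sinT (fun x => k * f x) t = k * sinT f t.
Proof.
move=> if_; rewrite /sinT -RintegralZl//; last exact: L1_sin.
by apply: eq_Rintegral => x _; rewrite mulrA.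
Qed.

Section transform_correlation.
Variables (f g : R -> R) (M : R).
Hypotheses (if_ : L1 f) (ig : L1 g) (gM : forall x, `|g x| <= M).

Lemma cosT_corr t : cosT (corr f g) t = cosT f t * cosT g t + sinT f t * sinT g t.
Proof.
have [_ E] := corr_pairing if_ ig gM (measurable_cosM t) (fun v => cos_max (t * v)).
rewrite {1}/cosT E -[cosT f t * _]RintegralZr//; last exact: L1_cos.
rewrite -[sinT f t * _]RintegralZr//; last exact: L1_sin.
rewrite -RintegralD//; last 2 first.
- exact: (integrableZr measurableT (cosT g t) (L1_cos t if_)).
- exact: (integrableZr measurableT (sinT g t) (L1_sin t if_)).
apply: eq_Rintegral => x _; rewrite -!mulrA -mulrDr; congr (_ * _).
rewrite /cosT /sinT -!RintegralZl//; [|first [exact: L1_cos|exact: L1_sin]..].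
rewrite -RintegralD//; [|first [exact/L1_scale/L1_cos|exact/L1_scale/L1_sin]..].
by apply: eq_Rintegral => y _; rewrite mulrBr cosB; ring.
Qed.

Lemma sinT_corr t : sinT (corr f g) t = cosT f t * sinT g t - sinT f t * cosT g t.
Proof.
have [_ E] := corr_pairing if_ ig gM (measurable_sinM t) (fun v => sin_max (t * v)).
rewrite {1}/sinT E -[cosT f t * _]RintegralZr//; last exact: L1_cos.
rewrite -[sinT f t * _]RintegralZr//; last exact: L1_sin.
rewrite -RintegralB//; last 2 first.
- exact: (integrableZr measurableT (sinT g t) (L1_cos t if_)).
- exact: (integrableZr measurableT (cosT g t) (L1_sin t if_)).
apply: eq_Rintegral => x _; rewrite -!mulrA -mulrBr; congr (_ * _).
rewrite /cosT /sinT -!RintegralZl//; [|first [exact: L1_cos|exact: L1_sin]..].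
rewrite -RintegralB//; [|first [exact/L1_scale/L1_cos|exact/L1_scale/L1_sin]..].
by apply: eq_Rintegral => y _; rewrite mulrBr sinB; ring.
Qed.

End transform_correlation.

(** Squared modulus of the Fourier transform. *)
Definition spectrum f t := cosT f t ^+ 2 + sinT f t ^+ 2.

Lemma spectrumE f M t : L1 f -> (forall x, `|f x| <= M) ->
  spectrum f t = cosT (corr f f) t.
Proof. by move=> if_ fM; rewrite (cosT_corr if_ if_ fM)// !expr2. Qed.

Lemma measurable_spectrum f : L1 f -> measurable_fun setT (spectrum f).
Proof.
move=> if_; apply: measurable_funD; apply: measurable_funX.
  exact: continuous_measurable_fun (cosT_continuous if_).
exact: continuous_measurable_fun (sinT_continuous if_).
Qed.

Lemma spectrum_ge0 f t : 0 <= spectrum f t.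
Proof. by rewrite addr_ge0// sqr_ge0. Qed.

Lemma L1_exponential_pdf (e : R) : 0 < e -> L1 (exponential_pdf e).
Proof. exact: integrable_exponential_pdf. Qed.

(** This covers cosine and sine at once: [c] is one of them up to sign, with c' = - s and s' = c.
    The fundamental theorem of calculus on a half-line concerns nonnegative integrands, and is
    therefore applied to 1 + c. *)
Lemma laplace_phase (c s : R -> R) (e x : R) : 0 < e ->
  (forall y : R, is_derive y 1 c (- s y)) -> (forall y : R, is_derive y 1 s (c y)) ->
  (forall y : R, `|c y| <= 1) -> (forall y : R, `|s y| <= 1) ->
  \int[mu]_t (exponential_pdf e t * c (x * t)) =
  (e ^+ 2 * c 0 - e * x * s 0) / (e ^+ 2 + x ^+ 2).
Proof.
move=> e0 dc ds c1 s1.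
have ipdf := L1_exponential_pdf e0.
have cc : continuous c.
  by move=> y; apply: differentiable_continuous; apply/derivable1_diffP/ex_derive.
have mc : measurable_fun setT (fun t => c (x * t)).
  apply: measurableT_comp; last exact: mulrl_measurable.
  exact: continuous_measurable_fun.
have ipc : L1 (fun t => exponential_pdf e t * c (x * t)).
  exact: (@L1_mulr _ _ _ _ _ _ 1).
set D := e ^+ 2 + x ^+ 2.
have Dgt0 : 0 < D by rewrite ltr_wpDr ?sqr_ge0// exprn_gt0.
have D0 : D != 0 by rewrite gt_eqF.
pose F (t : R) : R := expR (- e * t) * (- 1 + e * (x * s (x * t) - e * c (x * t)) / D).
pose f (t : R) : R := e * expR (- e * t) * (1 + c (x * t)).
have dlin (k t : R) : is_derive t 1 (fun t : R => k * t) k.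
  by apply: is_derive_eq; rewrite /GRing.scale/= mulr1.
have dcx (t : R) : is_derive t 1 (fun t => c (x * t)) (- s (x * t) * x).
  exact: is_derive1_comp.
have dsx (t : R) : is_derive t 1 (fun t => s (x * t)) (c (x * t) * x).
  exact: is_derive1_comp.
have dex (t : R) : is_derive t 1 (fun t => expR (- e * t)) (expR (- e * t) * - e).
  exact: is_derive1_comp.
have cexp : continuous (fun t => expR (- e * t)).
  by move=> t; apply: differentiable_continuous; apply/derivable1_diffP/ex_derive.
have ccx : continuous (fun t => c (x * t)).
  by move=> t; apply: differentiable_continuous; apply/derivable1_diffP/ex_derive.
have dF (t : R) : is_derive t 1 F (f t).
  have dG := is_deriveB (is_deriveZ x (dsx t)) (is_deriveZ e (dcx t)).
  have dH := is_deriveD (is_derive_cst (-1 : R) t 1) (is_deriveZ (e / D) dG).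
  have dM := is_deriveM (dex t) dH.
  have -> : F = (fun t => expR (- e * t)) * (cst (-1) + (e / D) \*: ((x \*: (fun t => s (x * t))) - (e \*: (fun t => c (x * t))))).
    apply/funext => z; transitivity (expR (- e * z) *
      (-1 + (e / D) * (x * s (x * z) - e * c (x * z)))); last by [].
    by rewrite /F; ring.
  apply: (is_derive_eq dM).
  transitivity (expR (- e * t) * (0 + e / D * (x * (c (x * t) * x) - e * (- s (x * t) * x))) +
      (- 1 + e / D * (x * s (x * t) - e * c (x * t))) * (expR (- e * t) * - e)); first by [].
  by rewrite /f; move: D0; rewrite /D => D0'; field.
have f0 t : 0 <= f t.
  rewrite mulr_ge0 ?mulr_ge0 ?expR_ge0 ?(ltW e0)//.
  by have := c1 (x * t); rewrite ler_norml => /andP[? _]; rewrite -lerBlDl sub0r.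
have FTC : \int[mu]_(t in `[0, +oo[) f t = - F 0.
  rewrite (@Rintegral_ge0_continuous_FTC2y _ f F 0 0) ?sub0r//.
  - apply: continuous_subspaceT => t; apply: cvgM.
      apply: cvgM; first exact: cvg_cst.
      exact: cexp.
    by apply: cvgD; [exact: cvg_cst|exact: ccx].
  - have e_cvg : expR (- e * t) @[t --> +oo] --> 0.
      rewrite (_ : (fun t => _) = (fun z => expR (- z)) \o (fun z => e * z)); last first.
        by apply: eq_fun => t; rewrite mulNr.
      apply: (@cvg_comp _ _ _ _ _ _ (pinfty_nbhs R)); last exact: cvgr_expR.
      exact: gt0_cvgMry.
    pose K := 1 + e / D * (`|x| + e).
    have Ke_cvg : K * expR (- e * t) @[t --> +oo] --> 0.
      by rewrite -(mulr0 K); apply: cvgM => //; exact: cvg_cst.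
    have NKe_cvg : - (K * expR (- e * t)) @[t --> +oo] --> 0.
      by rewrite -oppr0; apply: cvgN.
    apply: squeeze_cvgr NKe_cvg Ke_cvg; apply: nearW => t; rewrite -ler_norml.
    rewrite /F normrM ger0_norm ?expR_ge0// mulrC ler_wpM2r ?expR_ge0//.
    rewrite (le_trans (ler_normD _ _))// normrN1 lerD2l mulrAC normrM.
    have De0 : 0 <= e / D by apply: divr_ge0; [exact: (ltW e0)|exact: (ltW Dgt0)].
    rewrite ger0_norm// ler_wpM2l// (le_trans (ler_normB _ _))// !normrM.
    by apply: lerD; [rewrite ler_piMr|rewrite gtr0_norm// ler_piMr// ltW].
  - by apply: cvg_at_right_filter; apply: differentiable_continuous; apply/derivable1_diffP/ex_derive.
  - by move=> t _; rewrite derive1E; exact: derive_val.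
have : \int[mu]_t (exponential_pdf e t + exponential_pdf e t * c (x * t)) = - F 0.
  rewrite -FTC [RHS]Rintegral_mkcond; apply: eq_Rintegral => t _.
  rewrite patchE; case: ifPn => [|]; rewrite ?inE ?notin_setE/= in_itv/= andbT.
    by move=> t0; rewrite exponential_pdfE// /f; ring.
  by move=> /negP; rewrite -ltNge => t0; rewrite lt0_exponential_pdf// !mul0r addr0.
rewrite RintegralD// {1}/Rintegral integral_exponential_pdf//= => H.
rewrite (_ : \int[mu]_t _ = - F 0 - 1); last by rewrite -H addrC addKr.
by rewrite /F mulr0 mulr0 expR0; field.
Qed.

Lemma cosT_exponential_pdf (e x : R) : 0 < e ->
  cosT (exponential_pdf e) x = e ^+ 2 / (e ^+ 2 + x ^+ 2).
Proof.
move=> e0; rewrite /cosT (@laplace_phase cos sin)//.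
- by rewrite cos0 sin0 mulr1 mulr0 subr0.
- exact: cos_max.
- exact: sin_max.
Qed.

Lemma sinT_exponential_pdf (e x : R) : 0 < e ->
  sinT (exponential_pdf e) x = e * x / (e ^+ 2 + x ^+ 2).
Proof.
move=> e0.
have ds (y : R) : is_derive y 1 sin (- - cos y).
  by rewrite opprK; exact: is_derive_sin.
have dc (y : R) : is_derive y 1 (fun y => - cos y) (sin y).
  by have := is_deriveN (is_derive_cos y); rewrite opprK.
have c1 (y : R) : `|- cos y| <= 1 by rewrite normrN cos_max.
rewrite /sinT (laplace_phase x e0 ds dc (@sin_max R) c1).
by rewrite cos0 sin0 mulr0 mulrN1 opprK add0r.
Qed.

Lemma L1_cauchy : L1 (fun x => (1 + x ^+ 2)^-1).
Proof.
have mc : continuous (fun x : R => (1 + x ^+ 2)^-1).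
  exact: continuous_oneDsqrV.
have c0 x : 0 <= (1 + x ^+ 2)^-1 :> R by rewrite invr_ge0 addr_ge0// sqr_ge0.
apply/integrableP; split.
  by apply/measurable_EFinP; exact: continuous_measurable_fun.
apply: (@le_lt_trans _ _ (\int[mu]_x ((1 + x ^+ 2)^-1)%R%:E)%E).
  by rewrite le_eqVlt; apply/orP; left; apply/eqP/eq_integral => x _ /=; rewrite ger0_norm.
rewrite ge0_symfun_integralT//; last by move=> x /=; rewrite sqrrN.
rewrite (_ : [set x | _] = `[0, +oo[%classic); last first.
  by apply/seteqP; split => x /=; rewrite in_itv/= andbT.
by have := @integral0y_oneDsqr R; rewrite /oneDsqr/= => ->; rewrite -EFinM ltry.
Qed.

Lemma cauchy_mass_gt0 : 0 < \int[mu]_x (1 + x ^+ 2)^-1 :> R.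
Proof.
have i1 : L1 (fun x => 2^-1 * \1_(`[0, 1] : set R) x).
  by apply: L1_scale; exact: integrable_indic_itv.
apply: (@lt_le_trans _ _ (\int[mu]_x (2^-1 * \1_(`[0, 1] : set R) x))).
  rewrite RintegralZl//; last first.
    exact: integrable_indic_itv.
  rewrite mulr_gt0// /Rintegral integral_indic//= setIT lebesgue_measure_itv/=.
  by rewrite lte01/= subr0.
apply: le_Rintegral => //; first exact: L1_cauchy.
move=> x _; rewrite indicE; have [|_] := boolP (x \in _).
  rewrite inE/= in_itv/= => /andP[x0 x1]; rewrite mulr1 lef_pV2 ?posrE//.
    by rewrite -lerBrDl (_ : 2 - 1 = 1 :> R) ?expr_le1//; ring.
  by rewrite ltr_pwDl// sqr_ge0.
by rewrite mulr0 invr_ge0 addr_ge0// sqr_ge0.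
Qed.

(** Let A be the autocorrelation of r; its cosine transform is the spectrum, and A(0) is the
    integral of r^2.  Inserting the weight e^(-e t) for t > 0 in the integral of the spectrum gives,
    by Fubini's theorem, the integral of A(v) e / (e^2 + v^2), that is of A(e x) / (1 + x^2).
    As e tends to 0 this tends to A(0) times the integral of 1 / (1 + x^2), because A is bounded
    and continuous. *)
Lemma plancherel_le r (M : R) : L1 r -> (forall x, `|r x| <= M) ->
  (forall x, x != 0 -> {for x, continuous r}) -> L1 (spectrum r) ->
  (\int[mu]_x (1 + x ^+ 2)^-1) * \int[mu]_x r x ^+ 2 <= \int[mu]_t spectrum r t.
Proof.
move=> ir rM cr iQ; set K := \int[mu]_x _.
pose A := corr r r.
have iA : L1 A by exact: corr_L1 rM.
have cA : continuous A by exact: (corr_continuous ir (L1_measurable ir) rM cr).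
have AM := corr_le ir ir rM; rewrite -/A in AM; set N := M * _ in AM.
have A0 : A 0 = \int[mu]_x r x ^+ 2.
  by apply: eq_Rintegral => x _; rewrite addr0 expr2.
pose cw (x : R) := (1 + x ^+ 2)^-1.
have icw : L1 cw by exact: L1_cauchy.
have cw0 x : 0 <= cw x by rewrite invr_ge0 addr_ge0// sqr_ge0.
have step (e : R) : 0 < e -> \int[mu]_x (cw x * A (e * x)) <= \int[mu]_t spectrum r t.
  move=> e0; have ip := L1_exponential_pdf e0.
  have mp := L1_measurable ip.
  pose k (x v : R) := A v * cos (x * v).
  have mk : measurable_fun setT (fun z : R * R => k z.1 z.2).
    apply: measurable_funM.
      exact: (measurableT_comp (L1_measurable iA) (@measurable_snd _ _ _ _)).
    apply: measurableT_comp; first exact: continuous_measurable_fun (@continuous_cos R).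
    exact: measurable_funM.
  have kA x : \int[mu]_v `|k x v| <= \int[mu]_v `|A v|.
    apply: le_Rintegral => //; [exact/integrable_norm/L1_cos|exact: integrable_norm|].
    by move=> v _; rewrite normrM ler_piMr// cos_max.
  have kN x v : `|k x v| <= N.
    by rewrite normrM (le_trans _ (AM v))// ler_piMr// cos_max.
  have c1 (v : R) : `|(cst 1 : R -> R) v| <= 1 by rewrite normr1.
  have [iAc FT] := kernel_pairing ip mk (fun x => L1_cos x iA) kA kN
    (measurable_cst _) c1.
  pose g v := e^-1 * (\int[mu]_x (exponential_pdf e x * k x v) * cst 1 v).
  have gE v : g v = e / (e ^+ 2 + v ^+ 2) * A v.
    rewrite /g mulr1 (_ : \int[mu]_x _ = A v * cosT (exponential_pdf e) v).
      by rewrite cosT_exponential_pdf//; field; rewrite !gt_eqF// ltr_wpDr ?sqr_ge0 ?exprn_gt0.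
    rewrite -RintegralZl//; last exact: L1_cos.
    by apply: eq_Rintegral => x _; rewrite /k (mulrC v); ring.
  have ig : L1 g by exact: L1_scale.
  have [ige gscale] := Rintegral_scale e0 ig.
  have -> : \int[mu]_x (cw x * A (e * x)) = \int[mu]_v g v.
    rewrite -gscale -RintegralZl//; apply: eq_Rintegral => x _; rewrite gE /cw; field.
    rewrite (gt_eqF (_ : 0 < 1 + x ^+ 2)) ?ltr_pwDl ?sqr_ge0//.
    by rewrite andbT gt_eqF// (ltr_wpDr (sqr_ge0 _))// exprn_gt0.
  have FT' : \int[mu]_x (exponential_pdf e x * \int[mu]_v (k x v * cst 1 v)) =
      \int[mu]_x (spectrum r x * exponential_pdf e x).
    apply: eq_Rintegral => x _; rewrite mulrC (spectrumE _ ir rM); congr (_ * _).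
    by apply: eq_Rintegral => v _; rewrite mulr1.
  have pe t : `|exponential_pdf e t| <= e.
    rewrite ger0_norm; last by apply: exponential_pdf_ge0; exact: ltW.
    have [t0|t0] := leP 0 t; last by rewrite lt0_exponential_pdf// ltW.
    rewrite exponential_pdfE//= ler_piMr ?(ltW e0)// expR_le1 mulNr oppr_le0.
    by rewrite mulr_ge0// ltW.
  have iQp : L1 (fun t => spectrum r t * exponential_pdf e t) by exact: (L1_mulr iQ mp pe).
  rewrite /g RintegralZl// FT FT' -RintegralZl//.
  apply: le_Rintegral => //; first exact: L1_scale.
  move=> t _; rewrite mulrCA ler_piMr ?spectrum_ge0// mulrC ler_pdivrMr// mul1r.
  exact: le_trans (ler_norm _) (pe t).
have lim : (fun n => \int[mu]_x (cw x * A (n.+1%:R^-1 * x))) @ \oo --> \int[mu]_x (cw x * A 0).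
  apply: (@Rdominated_cvg _ _ _ mu _ _ (fun x => N * cw x)).
  - move=> n; apply: measurable_funM; first exact: L1_measurable icw.
    apply: measurableT_comp; last exact: mulrl_measurable.
    exact: L1_measurable iA.
  - by apply: measurable_funM; first exact: L1_measurable icw.
  - apply: aeW => x; apply: cvgM; first exact: cvg_cst.
    apply: (@cvg_comp _ _ _ (fun n => n.+1%:R^-1 * x) A); last exact: cA.
    rewrite -(mul0r x); apply: cvgM; last exact: cvg_cst.
    exact: cvg_harmonic.
  - exact: L1_scale.
  - by move=> n x; rewrite normrM ger0_norm// [leRHS]mulrC ler_wpM2l.
rewrite -A0 -RintegralZr//.
apply: (@cvgr_to_le _ _ _ _ _ _ _ lim).
by apply: nearW => n; apply: step.
Qed.

End fourier.

(** * Taylor remainders and exponential decay *)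

Section tails.
Context {R : realType}.
Notation mu := (@lebesgue_measure R).
Notation L1 f := (mu.-integrable setT (EFin \o f)).

(** For i >= N and th <= 1 one has z^i <= th^N (z / th)^i.  The free parameter th is used in two
    ways: a fixed th < 1 gives convergence as N grows, while th proportional to a step h gives a
    remainder of order h^N. *)
Lemma series_tail_le (a : R^nat) (z th l : R) (N : nat) :
  0 <= z -> 0 < th <= 1 -> (forall i, `|a i| <= z ^+ i / i`!%:R) ->
  series a @ \oo --> l -> `|l - series a N| <= th ^+ N * expR (z / th).
Proof.
move=> z0 /andP[th0 th1] az al.
have lim : (fun n => `|series a n - series a N|) @ \oo --> `|l - series a N|.
  by apply: cvg_norm; apply: cvgB => //; exact: cvg_cst.
apply: (cvgr_to_le lim); near=> n.
have Nn : (N <= n)%N by near: n; exact: nbhs_infty_ge.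
rewrite sub_series_geq//; apply: (le_trans (ler_norm_sum _ _ _)).
have zth0 : 0 <= z / th by rewrite divr_ge0 ?(ltW th0).
apply: (@le_trans _ _ (th ^+ N * \sum_(N <= i < n) exp_coeff (z / th) i)).
  rewrite mulr_sumr big_nat_cond [leRHS]big_nat_cond.
  apply: ler_sum => i /andP[/andP[Ni _] _].
  apply: (le_trans (az i)); rewrite /exp_coeff/= mulrA ler_wpM2r ?invr_ge0//.
  rewrite expr_div_n mulrCA -[leLHS]mulr1 ler_wpM2l ?exprn_ge0//.
  by rewrite -(subnKC Ni) exprD invfM mulrA divff ?mul1r ?gt_eqF ?exprn_gt0// invf_ge1 ?exprn_gt0// exprn_ile1// ltW.
rewrite ler_wpM2l ?exprn_ge0 ?(ltW th0)//.
apply: (@le_trans _ _ (series (exp_coeff (z / th)) n)).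
  rewrite /series/= [leRHS](big_cat_nat _ Nn)//= lerDr.
  by apply: sumr_ge0 => i _; exact: exp_coeff_ge0.
apply: nondecreasing_cvgn_le; last exact: is_cvg_series_exp_coeff.
by apply: nondecreasing_series => i _ _; exact: exp_coeff_ge0.
Unshelve. all: by end_near. Qed.

(** Taylor coefficients of cosine at 0; those of sine follow. *)
Definition cosc (i : nat) : R := (~~ odd i)%:R * (-1) ^+ i./2 / i`!%:R.
Definition sinc (i : nat) : R := (odd i)%:R * (-1) ^+ i.-1./2 / i`!%:R.

Lemma cos_tail_le (z th : R) N : 0 < th <= 1 ->
  `|cos z - \sum_(i < N) cosc i * z ^+ i| <= th ^+ N * expR (`|z| / th).
Proof.
move=> th01; have := @is_cvg_series_cos_coeff _ z => /cvg_ex[l zl].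
have -> : cos z = l by rewrite cos.unlock; exact/cvg_lim.
have -> : \sum_(i < N) cosc i * z ^+ i = series (cos_coeff z) N.
  by rewrite /series/= big_mkord cos_coeffE.
apply: series_tail_le => // i; rewrite cos_coeffE/= -normrX normrM [leLHS]mulrC ler_wpM2l//.
rewrite normrM (ger0_norm (_ : 0 <= i`!%:R^-1)) ?invr_ge0// ler_piMl ?invr_ge0//.
by rewrite normrM normrX normrN1 expr1n mulr1; case: odd; rewrite ?normr0 ?normr1.
Qed.

Lemma sin_tail_le (z th : R) N : 0 < th <= 1 ->
  `|sin z - \sum_(i < N) sinc i * z ^+ i| <= th ^+ N * expR (`|z| / th).
Proof.
move=> th01; have := @is_cvg_series_sin_coeff _ z => /cvg_ex[l zl].
have -> : sin z = l by rewrite sin.unlock; exact/cvg_lim.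
have -> : \sum_(i < N) sinc i * z ^+ i = series (sin_coeff z) N.
  by rewrite /series/= big_mkord sin_coeffE.
apply: series_tail_le => // i; rewrite sin_coeffE/= -normrX normrM [leLHS]mulrC ler_wpM2l//.
rewrite normrM (ger0_norm (_ : 0 <= i`!%:R^-1)) ?invr_ge0// ler_piMl ?invr_ge0//.
by rewrite normrM normrX normrN1 expr1n mulr1; case: odd; rewrite ?normr0 ?normr1.
Qed.

Lemma expR_tail_le (z th : R) N : 0 < th <= 1 ->
  `|expR z - \sum_(i < N) z ^+ i / i`!%:R| <= th ^+ N * expR (`|z| / th).
Proof.
move=> th01; have := @is_cvg_series_exp_coeff _ z => /cvg_ex[l zl].
have -> : expR z = l by exact/cvg_lim.
rewrite -(big_mkord xpredT (fun i => z ^+ i / i`!%:R)).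
apply: (@series_tail_le (exp_coeff z) `|z| th l N) => // i; rewrite /exp_coeff/= normrM normrX.
by rewrite (ger0_norm (_ : 0 <= i`!%:R^-1)) ?invr_ge0.
Qed.

Lemma exprn_le_expR (x b : R) (j : nat) : 0 <= x -> 0 < b ->
  x ^+ j <= j`!%:R / b ^+ j * expR (b * x).
Proof.
move=> x0 b0; have bx0 : 0 <= b * x by rewrite mulr_ge0// ltW.
rewrite -mulrA mulrC -ler_pdivrMr ?ltr0n ?fact_gt0//.
rewrite -[leRHS]mulrC ler_pdivlMr ?exprn_gt0//.
rewrite mulrAC -exprMn mulrC.
case: j => [|j]; first by rewrite expr0 fact0 invr1 mulr1 -expR0 ler_expR.
by apply: (le_trans _ (expR_ge1Dxn j bx0)); rewrite mulrC (mulrC x) lerDr.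
Qed.

Lemma L1_expN (b : R) : 0 < b -> L1 (fun u => expR (- (b * `|u|))).
Proof.
move=> b0; have ip := L1_exponential_pdf b0.
apply: (@L1_le _ _ _ mu _ (fun u : R => b^-1 * (exponential_pdf b u + exponential_pdf b (- u)))).
- apply: measurableT_comp => //; apply: measurableT_comp => //.
  by apply: measurable_funM => //; exact: measurableT_comp.
- move=> u; rewrite ger0_norm ?expR_ge0// [leRHS]mulrC ler_pdivlMr// [leLHS]mulrC.
  have [u0|u0] := leP 0 u.
    by rewrite exponential_pdfE//= ger0_norm// mulNr lerDl exponential_pdf_ge0// ltW.
  rewrite ltr0_norm// (exponential_pdfE b (_ : 0 <= - u)) ?oppr_ge0 ?(ltW u0)//=.
  by rewrite mulNr lerDr exponential_pdf_ge0// ltW.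
- by apply: L1_scale; apply: L1_add => //; exact: (L1_oppr ip).
Qed.

Lemma L1_powexp (b : R) (j : nat) : 0 < b -> L1 (fun u => `|u| ^+ j * expR (- (b * `|u|))).
Proof.
move=> b0; have b20 : 0 < b / 2 by rewrite divr_gt0.
apply: (@L1_le _ _ _ mu _ (fun u : R => (j`!%:R / (b / 2) ^+ j) * expR (- (b / 2 * `|u|)))).
- apply: measurable_funM; first by apply: measurable_funX; exact: normr_measurable.
  apply: measurableT_comp => //; apply: measurableT_comp => //.
  by apply: measurable_funM => //; exact: measurableT_comp.
- move=> u; rewrite ger0_norm ?mulr_ge0 ?expR_ge0 ?exprn_ge0//.
  rewrite (_ : - (b * `|u|) = - (b / 2 * `|u|) - b / 2 * `|u|); last by field.
  rewrite expRD mulrA ler_wpM2r ?expR_ge0// expRN ler_pdivrMr ?expR_gt0//.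
  exact: exprn_le_expR.
- by apply: L1_scale; exact: L1_expN.
Qed.

Lemma Rintegral_sum d (T : measurableType d) (m : {measure set T -> \bar R})
    (F : nat -> T -> R) N : (forall i, m.-integrable setT (EFin \o F i)) ->
  m.-integrable setT (EFin \o (fun x => \sum_(i < N) F i x)) /\
  \int[m]_x (\sum_(i < N) F i x) = \sum_(i < N) \int[m]_x F i x.
Proof.
move=> iF; elim: N => [|N [IHi IH]].
  split; last by under eq_Rintegral do rewrite big_ord0; rewrite big_ord0 /Rintegral integral0.
  apply: eq_integrable (integrable0 m setT) => // x _.
  by rewrite /= big_ord0.
split; last first.
  rewrite big_ord_recr/= -IH -RintegralD//.
  by apply: eq_Rintegral => x _; rewrite big_ord_recr.
apply: eq_integrable (L1_add IHi (iF N)) => // x _.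
by rewrite /= big_ord_recr.
Qed.

End tails.

(** * Almost everywhere nonvanishing of a Fourier transform *)

Section isolated.
Context {R : realType}.

(** An isolated zero is the only zero in some interval with rational endpoints. *)
Lemma isolated_zeros_countable (f : R -> R) :
  countable [set t | f t = 0 /\
    exists2 d, 0 < d & forall h, 0 < `|h| < d -> f (t + h) != 0].
Proof.
pose S (q : rat * rat) := [set t : R | f t = 0 /\ ratr q.1 < t < ratr q.2 /\
  forall t', ratr q.1 < t' < ratr q.2 -> f t' = 0 -> t' = t].
apply: (@sub_countable _ _ _ (\bigcup_q S q)).
  apply: subset_card_le => t [ft [d d0 fh]].
  have [q1 q1P] := @rat_in_itvoo R (t - d) t (ltac:(by rewrite ltrBlDr ltrDl)).
  have [q2 q2P] := @rat_in_itvoo R t (t + d) (ltac:(by rewrite ltrDl)).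
  exists (q1, q2) => //; split => //=.
  move: q1P q2P; rewrite !in_itv/= => /andP[dq1 q1t] /andP[tq2 q2d].
  split; first by rewrite q1t tq2.
  move=> t' /andP[q1t' t'q2] ft'; apply: contrapT => /eqP t't.
  suff : false by []; have := fh (t' - t); rewrite (addrC t) subrK ft' eqxx; apply.
  rewrite normr_gt0 subr_eq0 t't/= ltr_norml ltrBrDr ltrBlDr.
  by rewrite (addrC (- d)) (lt_trans dq1 q1t')/= (addrC d) (lt_trans t'q2).
apply: bigcup_countable => //= q _.
have [->|/set0P[x Sx]] := eqVneq (S q) set0; first exact: countable0.
apply: (@sub_countable _ _ _ [set x]); last exact: countable1.
apply: subset_card_le => y [fy [yq _]].
by move: Sx => [_ [_]]; apply.
Qed.

End isolated.

Section zero_set.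
Context {R : realType}.
Notation mu := (@lebesgue_measure R).
Notation L1 f := (mu.-integrable setT (EFin \o f)).

Variables (H : R -> R) (C a : R).
Hypothesis mH : measurable_fun setT H.
Hypothesis a0 : 0 < a.
Hypothesis HC : forall u, `|H u| <= C * expR (- (a * `|u|)).

Let C0 : 0 <= C.
Proof.
by have := le_trans (normr_ge0 _) (HC 0); rewrite normr0 mulr0 oppr0 expR0 mulr1.
Qed.

Let mphase (t b : R) : measurable_fun setT (fun u : R => cos (t * u + b)).
Proof.
apply: measurableT_comp; first exact: continuous_measurable_fun (@continuous_cos R).
by apply: measurable_funD => //; exact: mulrl_measurable.
Qed.

(** As differentiation in t shifts both the power of u and the phase, moment j j is the j-th
    derivative of the cosine transform, and moment j.+3 j that of the sine transform. *)
Definition moment (k j : nat) (t : R) : R :=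
  \int[mu]_u (H u * u ^+ j * cos (t * u + k%:R * (pi / 2))).

Lemma L1_moment k j t : L1 (fun u => H u * u ^+ j * cos (t * u + k%:R * (pi / 2))).
Proof.
apply: (@L1_le _ _ _ mu _ (fun u : R => C * (`|u| ^+ j * expR (- (a * `|u|))))).
- apply: measurable_funM; last exact: mphase.
  by apply: measurable_funM => //; exact: measurable_funX.
- move=> u; rewrite normrM (le_trans (ler_piMr _ (cos_max _)))// normrM normrX.
  rewrite (_ : C * _ = (C * expR (- (a * `|u|))) * `|u| ^+ j); last by ring.
  by rewrite ler_wpM2r// exprn_ge0.
- exact/L1_scale/L1_powexp.
Qed.

Definition moment_bound (j : nat) : R :=
  2 * C * \int[mu]_u (`|u| ^+ j * expR (- (a / 2 * `|u|))).

(** Expand cos (h u) and sin (h u) under the integral sign; the exponential decay of [H] absorbs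
    the growth of the remainder. *)
Lemma moment_taylor k j (t h th : R) N : 0 < th <= 1 -> `|h| / th <= a / 2 ->
  `|moment k j (t + h) - \sum_(i < N)
     h ^+ i * (cosc i * moment k (j + i) t + sinc i * moment k.+1 (j + i) t)|
  <= th ^+ N * moment_bound j.
Proof.
move=> th01 hth; have /andP[th0 th1] := th01.
pose A u := cos (t * u + k%:R * (pi / 2)).
pose B u := cos (t * u + k.+1%:R * (pi / 2)).
pose G (i : nat) u := h ^+ i * (cosc i * (H u * u ^+ (j + i) * A u) +
                                sinc i * (H u * u ^+ (j + i) * B u)).
have iG i : L1 (G i).
  by apply: L1_scale; apply: L1_add; apply: L1_scale; exact: L1_moment.
have [iS SE] := Rintegral_sum N iG.
have -> : \sum_(i < N) h ^+ i * (cosc i * moment k (j + i) t +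
    sinc i * moment k.+1 (j + i) t) = \int[mu]_u \sum_(i < N) G i u.
  rewrite SE; apply: eq_bigr => i _; rewrite RintegralZl//.
    congr (_ * _); rewrite RintegralD//; [|exact/L1_scale/L1_moment..].
    by rewrite !RintegralZl//; exact: L1_moment.
  by apply: L1_add; apply: L1_scale; exact: L1_moment.
rewrite -RintegralB//; last exact: L1_moment.
have ib : L1 (fun u => `|u| ^+ j * expR (- (a / 2 * `|u|))).
  by apply: L1_powexp; rewrite divr_gt0.
rewrite /moment_bound [leRHS]mulrA -RintegralZl//.
apply: le_norm_Rintegral; [apply: L1_sub => //; exact: L1_moment|exact: L1_scale|].
move=> u.
set x := h * u.
have -> : H u * u ^+ j * cos ((t + h) * u + k%:R * (pi / 2)) - \sum_(i < N) G i u =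
  H u * u ^+ j * ((cos x - \sum_(i < N) cosc i * x ^+ i) * A u +
                  (sin x - \sum_(i < N) sinc i * x ^+ i) * B u).
  have -> : cos ((t + h) * u + k%:R * (pi / 2)) = cos x * A u + sin x * B u.
    rewrite (_ : (t + h) * u + _ = x + (t * u + k%:R * (pi / 2))); last by rewrite /x; ring.
    rewrite cosD /B (_ : t * u + k.+1%:R * (pi / 2) = (t * u + k%:R * (pi / 2)) + pi / 2).
      by rewrite cosDpihalf mulrN.
    by rewrite -natr1; ring.
  have -> : \sum_(i < N) G i u = H u * u ^+ j *
     ((\sum_(i < N) cosc i * x ^+ i) * A u + (\sum_(i < N) sinc i * x ^+ i) * B u).
    rewrite !mulr_suml -big_split/= mulr_sumr; apply: eq_bigr => i _.
    by rewrite /G /x exprD exprMn; ring.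
  by ring.
have tails : `|(cos x - \sum_(i < N) cosc i * x ^+ i) * A u +
    (sin x - \sum_(i < N) sinc i * x ^+ i) * B u| <= 2 * th ^+ N * expR (a / 2 * `|u|).
  have ex : expR (`|x| / th) <= expR (a / 2 * `|u|).
    by rewrite ler_expR /x normrM mulrAC ler_wpM2r.
  have thN0 : 0 <= th ^+ N by rewrite exprn_ge0// ltW.
  rewrite (_ : 2 * _ * _ = th ^+ N * expR (a / 2 * `|u|) + th ^+ N * expR (a / 2 * `|u|)); last by ring.
  apply: (le_trans (ler_normD _ _)); rewrite !normrM; apply: lerD.
    rewrite -[leRHS]mulr1 ler_pM ?cos_max// (le_trans (cos_tail_le _ _ th01))//.
    exact: ler_wpM2l.
  rewrite -[leRHS]mulr1 ler_pM ?cos_max// (le_trans (sin_tail_le _ _ th01))//.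
  exact: ler_wpM2l.
rewrite normrM normrM normrX.
apply: (@le_trans _ _ ((C * expR (- (a * `|u|)) * `|u| ^+ j) *
    (2 * th ^+ N * expR (a / 2 * `|u|)))).
  by rewrite ler_pM// ler_wpM2r// exprn_ge0.
rewrite (_ : - (a * `|u|) = - (a / 2 * `|u|) - a / 2 * `|u|); last by field.
rewrite expRD (expRN (a / 2 * `|u|)) le_eqVlt; apply/orP; left; apply/eqP.
by field; rewrite gt_eqF// expR_gt0.
Qed.

Let D := [set t | forall k j, moment k j t = 0].

(** Where all moments vanish, so do the Taylor polynomials, and the remainder tends to 0 on a
    neighbourhood whose size depends on [a] only. *)
Let D_shift t h : D t -> `|h| <= a / 4 -> D (t + h).
Proof.
move=> Dt ha k j; apply/eqP; rewrite -normr_le0; apply/ler_addgt0Pr => e e0; rewrite add0r.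
have lim : (fun N => 2^-1 ^+ N * moment_bound j) @ \oo --> (0 : R).
  rewrite -(mul0r (moment_bound j)); apply: cvgM; last exact: cvg_cst.
  by apply: cvg_expr; rewrite ger0_norm// invf_lt1// ltr1n.
have /cvgrPdist_lt/(_ e e0)[N _ /(_ N (leqnn N))] := lim.
rewrite /= sub0r normrN => /ltW; apply: le_trans.
have := @moment_taylor k j t h 2^-1 N _ _.
rewrite big1 ?subr0; last by move=> i _; rewrite !Dt !mulr0 addr0 mulr0.
move=> h'; apply: le_trans (h' _ _) (ler_norm _).
  by rewrite invr_gt0 ltr0n/= invf_le1// ler1n.
by rewrite invrK mulrC -ler_pdivlMl// (le_trans ha)// le_eqVlt; apply/orP; left; apply/eqP; field.
Qed.

Hypothesis intH : \int[mu]_u H u != 0.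

(** Finitely many steps of size at most a / 4 lead from t to 0, where the moment with
    k = j = 0 is the integral of [H]. *)
Let D_empty t : ~ D t.
Proof.
move=> Dt; have [n nP] : exists n : nat, `|t| / (a / 4) < n.+1%:R.
  exists (Num.trunc (`|t| / (a / 4))); exact: truncnS_gt.
pose h := - t / n.+1%:R.
have ha : `|h| <= a / 4.
  rewrite normrM normrN normrV ?unitfE ?pnatr_eq0// (ger0_norm (_ : 0 <= n.+1%:R))//.
  by rewrite ler_pdivrMr// mulrC -ler_pdivrMr ?divr_gt0// ltW.
have Dm m : D (t + m%:R * h).
  elim: m => [|m IH]; first by rewrite mul0r addr0.
  by rewrite -natr1 mulrDl mul1r addrA; exact: D_shift.
have := Dm n.+1; rewrite (_ : t + _ = 0); last by rewrite /h mulrC divfK ?pnatr_eq0// subrr.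
move=> /(_ 0%N 0%N); rewrite /moment => h0; move/eqP: intH; apply; rewrite -[RHS]h0.
by apply: eq_Rintegral => u _; rewrite !mul0r addr0 cos0 !mulr1.
Qed.

Let momentSS k j t : moment k.+2 j t = - moment k j t.
Proof.
rewrite -mulN1r -RintegralZl//; last exact: L1_moment.
apply: eq_Rintegral => u _.
rewrite (_ : t * u + k.+2%:R * (pi / 2) = (t * u + k%:R * (pi / 2)) + pi).
  by rewrite cosDpi; ring.
by rewrite -addn2 natrD; field.
Qed.

Let zero_moment t : cosT H t = 0 -> sinT H t = 0 -> forall k, moment k 0 t = 0.
Proof.
move=> cH sH.
have m0 : moment 0 0 t = 0.
  by rewrite -cH; apply: eq_Rintegral => u _; rewrite mul0r addr0 expr0 mulr1.
have m1 : moment 1 0 t = 0.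
  rewrite -oppr0 -sH -mulN1r -RintegralZl//.
    by apply: eq_Rintegral => u _; rewrite mul1r cosDpihalf; ring.
  apply: L1_sin; apply: L1_le (L1_scale C (L1_expN a0)) => //.
move=> k; suff : moment k 0 t = 0 /\ moment k.+1 0 t = 0 by case.
by elim: k => // k [IH1 IH2]; split => //; rewrite momentSS IH1 oppr0.
Qed.

(** Expand to order two: the linear term is h times the nonzero moment, and the remainder,
    with th proportional to |h|, is of order h^2. *)
Let isolated k j t : moment k j t = 0 -> moment k.+1 j.+1 t != 0 ->
  exists2 d, 0 < d & forall h, 0 < `|h| < d -> moment k j (t + h) != 0.
Proof.
move=> m0 m1; set c := moment k.+1 j.+1 t in m1.
have c0 : 0 < `|c| by rewrite normr_gt0.
pose B := `|moment_bound j| + 1.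
have B0 : 0 < B by rewrite ltr_wpDl.
pose b := a / 2; have b0 : 0 < b by rewrite divr_gt0.
(* the second bound makes the remainder (|h| / b)^2 B smaller than |h| |c| *)
pose d := Num.min b (`|c| * b ^+ 2 / B).
exists d; first by rewrite lt_min b0 divr_gt0// mulr_gt0// exprn_gt0.
move=> h /andP[h0]; rewrite lt_min => /andP[hb hc].
have S2 : \sum_(i < 2) h ^+ i * (cosc i * moment k (j + i) t +
    sinc i * moment k.+1 (j + i) t) = h * c.
  rewrite !big_ord_recr big_ord0/= addn0 addn1 -/c m0 /cosc /sinc/= factS fact0.
  by field.
have th01 : 0 < `|h| / b <= 1 by rewrite divr_gt0// ler_pdivrMr// mul1r ltW.
have hth : `|h| / (`|h| / b) <= a / 2 by rewrite invf_div mulrCA divff ?mulr1// gt_eqF.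
have := @moment_taylor k j t h (`|h| / b) 2 th01 hth; rewrite S2 => T.
apply/eqP => mh; move: T; rewrite mh sub0r normrN normrM; apply/negP; rewrite -ltNge.
rewrite exprMn -mulrA expr2 -mulrA ltr_pM2l//.
rewrite exprVn.
apply: (@le_lt_trans _ _ (`|h| * (B / b ^+ 2))).
  rewrite ler_wpM2l// mulrC ler_wpM2r ?invr_ge0 ?exprn_ge0 ?(ltW b0)//.
  by rewrite /B (le_trans (ler_norm _))// lerDl.
by rewrite mulrC -ltr_pdivlMl ?divr_gt0 ?exprn_gt0// mulrC invf_div mulrA.
Qed.

(** At a common zero t of the two transforms all moments of order 0 vanish, but not all
    moments of all orders.  If j.+1 is the first order at which some moment is not 0, then t is an
    isolated zero of a moment of order j.  Hence the common zeros are among countably many points. *)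
Lemma spectrum_neq0_ae : {ae mu, forall t, spectrum H t != 0}.
Proof.
pose E (kj : nat * nat) := [set t | moment kj.1 kj.2 t = 0 /\
    exists2 d, 0 < d & forall h, 0 < `|h| < d -> moment kj.1 kj.2 (t + h) != 0].
have cE : countable (\bigcup_kj E kj).
  by apply: bigcup_countable => // kj _; exact: isolated_zeros_countable.
exists (\bigcup_kj E kj); split.
- exact: countable_measurable.
- exact: countable_lebesgue_measure0.
move=> t /= /negP; rewrite negbK /spectrum paddr_eq0 ?sqr_ge0// !sqrf_eq0.
move=> /andP[/eqP cH /eqP sH].
have z0 := zero_moment cH sH.
apply: contrapT => nE; apply: (@D_empty t).
suff : forall j k, moment k j t = 0 by move=> h k j; exact: h.
elim => [//|j IH].
have S k : moment k.+1 j.+1 t = 0.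
  apply: contrapT => /eqP mk; apply: nE; exists (k, j) => //; split; first exact: IH.
  by apply: isolated.
(* the phase 0 differs by pi from the phase k = 2 *)
case=> [|k //]; by have := S 1%N; rewrite momentSS => /eqP; rewrite oppr_eq0 => /eqP.
Qed.

End zero_set.

(** * The target function and the Landweber iteration *)

Section target.
Context {R : realType}.
Notation mu := (@lebesgue_measure R).
Notation L1 f := (mu.-integrable setT (EFin \o f)).

(** The function e^(u/2) on u <= 0, written as a reflected exponential density, whose transforms
    have been computed above. *)
Definition target (u : R) : R := 2 * exponential_pdf 2^-1 (- u).

Let half0 : 0 < 2^-1 :> R. Proof. by rewrite invr_gt0. Qed.

Lemma L1_target : L1 target.
Proof. exact: (L1_scale 2 (L1_oppr (L1_exponential_pdf half0))). Qed.

Lemma target_ge0 u : 0 <= target u.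
Proof. by rewrite mulr_ge0// exponential_pdf_ge0// ltW. Qed.

Lemma targetE u : target u = if u <= 0 then expR (u / 2) else 0.
Proof.
rewrite /target; case: ifPn => u0.
  rewrite exponential_pdfE ?oppr_ge0//= mulrA divff// mul1r.
  by congr expR; field.
by rewrite lt0_exponential_pdf ?mulr0// oppr_lt0 ltNge.
Qed.

Lemma target_le1 u : `|target u| <= 1.
Proof.
rewrite ger0_norm ?target_ge0// targetE; case: ifPn => // u0.
by rewrite expR_le1 mulr_le0_ge0.
Qed.

Lemma continuous_target x : x != 0 -> {for x, continuous target}.
Proof.
move=> x0; have [xn|xp|] := ltrgtP x 0; last by move/eqP: x0.
- have E : {near x, (fun u => expR (u / 2)) =1 target}.
    near=> u; rewrite targetE ifT// ltW//; near: u; exact: lt_nbhsl.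
  apply: cvg_trans (near_eq_cvg E) _ => //=.
  rewrite targetE ifT ?(ltW xn)//.
  have /(_ x) : continuous (fun u : R => expR (u / 2)); last by [].
  move=> y; apply: (@continuous_comp _ _ _ (fun u : R => u / 2) expR).
    exact: mulrr_continuous.
  exact: continuous_expR.
- have E : {near x, (fun u => 0) =1 target}.
    near=> u; rewrite targetE ifF//; apply/negbTE; rewrite -ltNge; near: u; exact: lt_nbhsr.
  apply: cvg_trans (near_eq_cvg E) _ => //=.
  by rewrite targetE ifF ?leNgt ?xp//; exact: cvg_cst.
Unshelve. all: by end_near. Qed.

Lemma spectrum_target t : spectrum target t = (4^-1 + t ^+ 2)^-1.
Proof.
have mp := L1_measurable (L1_exponential_pdf half0).
have ip := L1_oppr (L1_exponential_pdf half0).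
have cE : cosT target t = 2 * cosT (exponential_pdf 2^-1) t.
  rewrite (cosTZ 2 t ip) /cosT -[in RHS]Rintegral_oppr.
    by congr (_ * _); apply: eq_Rintegral => u _; rewrite mulrN cosN.
  by apply: measurable_funM => //; exact: measurable_cosM.
have sE : sinT target t = - (2 * sinT (exponential_pdf 2^-1) t).
  rewrite (sinTZ 2 t ip) -mulrN /sinT -[in RHS]Rintegral_oppr; last first.
    by apply: measurable_funM => //; exact: measurable_sinM.
  congr (_ * _); rewrite -mulN1r -RintegralZl//.
    by apply: eq_Rintegral => u _; rewrite mulrN sinN; ring.
  have := L1_oppr (L1_sin t (L1_exponential_pdf half0)); apply.
rewrite /spectrum cE sE cosT_exponential_pdf// sinT_exponential_pdf//.
have q0 : 0 < 4^-1 + t ^+ 2 by rewrite ltr_wpDr ?sqr_ge0.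
rewrite (_ : 2^-1 ^+ 2 = 4^-1 :> R); last by field.
have q1 : 1 + t ^+ 2 * 4 != 0 by rewrite gt_eqF// ltr_wpDr// mulr_ge0// sqr_ge0.
by field.
Qed.

Lemma L1_spectrum_target : L1 (spectrum target).
Proof.
apply: (@L1_le _ _ _ mu _ (fun t : R => 4 * (1 + t ^+ 2)^-1)).
- exact: measurable_spectrum L1_target.
- move=> t; rewrite ger0_norm ?spectrum_ge0// spectrum_target.
  have t2 := sqr_ge0 t.
  rewrite -[4]invrK -invfM lef_pV2 ?posrE; nra.
- exact: (L1_scale 4 L1_cauchy).
Qed.

End target.

Section landweber.
Context {R : realType}.
Notation mu := (@lebesgue_measure R).
Notation L1 f := (mu.-integrable setT (EFin \o f)).

Variables (H : R -> R) (M : R).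
Hypothesis cH : continuous H.
Hypothesis iH : L1 H.
Hypothesis HM : forall u, `|H u| <= M.
Hypothesis spectrumH : {ae mu, forall t, spectrum H t != 0}.

Let mH := L1_measurable iH.

Let corrH_linear f g k v : L1 f -> L1 g ->
  corr (fun x => f x + k * g x) H v = corr f H v + k * corr g H v.
Proof.
move=> if_ ig; have i1 := corr_L1r if_ iH HM v; have i2 := corr_L1r ig iH HM v.
rewrite /corr -RintegralZl// -RintegralD//; last exact: L1_scale.
by apply: eq_Rintegral => x _; ring.
Qed.

Let N := \int[mu]_x `|H x|.
(** The spectrum of [H] is at most 2 N^2; adding 1 keeps the constant meaningful when N = 0. *)
Let kappa := (2 * (N ^+ 2 + 1))^-1.

Let N0 : 0 <= N. Proof. exact: Rintegral_ge0. Qed.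

Let kappa0 : 0 < kappa.
Proof. by rewrite invr_gt0 mulr_gt0// ltr_wpDl// sqr_ge0. Qed.

(** The factor by which one step of the iteration multiplies Fourier transforms. *)
Definition damping (t : R) : R := 1 - kappa * spectrum H t.

Let spectrumH_le t : spectrum H t <= 2 * N ^+ 2.
Proof.
have sq (x : R) : `|x| <= N -> x ^+ 2 <= N ^+ 2.
  by move=> xN; rewrite -[x ^+ 2]real_normK ?num_real// lerXn2r ?nnegrE.
rewrite (_ : 2 * N ^+ 2 = N ^+ 2 + N ^+ 2); last by ring.
by apply: lerD; apply: sq; [exact: cosT_le|exact: sinT_le].
Qed.

Let damping01 t : 0 <= damping t <= 1.
Proof.
rewrite /damping subr_ge0 gerBl mulr_ge0 ?spectrum_ge0 ?(ltW kappa0)// andbT.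
rewrite mulrC ler_pdivrMr ?mul1r; last by rewrite mulr_gt0// ltr_wpDl// sqr_ge0.
by rewrite (le_trans (spectrumH_le t))// ler_pM2l// lerDl.
Qed.

(** With A f = corr f H, the step from f to f + kappa A r, where r = target - A f, turns the
    residual r into r - kappa A (A r).  Since A takes the transform r^ to the product of H^ with
    the complex conjugate of r^, its square multiplies r^ by the spectrum of [H]. *)
Lemma landweber_iterate n : exists2 f, L1 f & forall t,
  cosT (fun v => target v - corr f H v) t = damping t ^+ n * cosT target t /\
  sinT (fun v => target v - corr f H v) t = damping t ^+ n * sinT target t.
Proof.
elim: n => [|n [f if_ IH]].
  have corr0 : corr (fun=> 0) H = fun=> 0.
    apply/funext => v; rewrite /corr -[RHS](mul0r (\int[mu]_x H x)) -RintegralZl//.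
    by apply: eq_Rintegral => x _; rewrite !mul0r.
  exists (fun=> 0); first exact: integrable0.
  move=> t; rewrite corr0 !expr0 !mul1r; split; congr (_ _ _);
    by apply/funext => v; rewrite subr0.
pose r v := target v - corr f H v.
have icf : L1 (corr f H) by exact: (corr_L1 if_ iH HM).
have ir : L1 r by apply: L1_sub => //; exact: L1_target.
have icr : L1 (corr r H) by exact: (corr_L1 ir iH HM).
have iccr : L1 (corr (corr r H) H) by exact: (corr_L1 icr iH HM).
exists (fun x => f x + kappa * corr r H x).
  by apply: L1_add => //; exact: L1_scale.
have -> : (fun v => target v - corr (fun x => f x + kappa * corr r H x) H v) =
    (fun v => r v - kappa * corr (corr r H) H v).
  by apply/funext => v; rewrite corrH_linear// /r; ring.
move=> t; have [cr sr] := IH t; rewrite -/r in cr sr.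
have iks := L1_scale kappa iccr.
rewrite (cosTB t ir iks) (sinTB t ir iks) (cosTZ kappa t iccr) (sinTZ kappa t iccr).
rewrite (cosT_corr icr iH HM) (sinT_corr icr iH HM).
rewrite (cosT_corr ir iH HM) (sinT_corr ir iH HM) cr sr.
by rewrite exprS; move: (damping t ^+ n) => dn; rewrite /damping /spectrum; split; ring.
Qed.

(** After n steps the residual has spectrum damping^(2 n) times that of the target.  This tends to
    0 where the spectrum of [H] does not vanish, and the Plancherel inequality transfers the
    convergence to the residuals. *)
Lemma landweber (e : R) : 0 < e -> exists2 f, L1 f &
  \int[mu]_v (target v - corr f H v) ^+ 2 <= e.
Proof.
move=> e0; pose Q n t := damping t ^+ n.*2 * spectrum target t.
have mdamp : measurable_fun setT damping.
  apply: measurable_funB => //; apply: measurable_funM => //.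
  exact: measurable_spectrum.
have mQ n : measurable_fun setT (Q n).
  apply: measurable_funM; first exact: measurable_funX.
  exact: L1_measurable L1_spectrum_target.
have Qle n t : `|Q n t| <= spectrum target t.
  have /andP[d0 d1] := damping01 t.
  rewrite normrM ger0_norm ?exprn_ge0// ger0_norm ?spectrum_ge0//.
  by rewrite ler_piMl ?spectrum_ge0// exprn_ile1.
have iQ n : L1 (Q n) by exact: (@L1_le _ _ _ mu _ _ (mQ n) (Qle n) L1_spectrum_target).
have lim : (fun n => \int[mu]_t Q n t) @ \oo --> \int[mu]_t (cst 0 t : R).
  apply: (@Rdominated_cvg _ _ _ mu _ _ _ mQ _ _ L1_spectrum_target Qle) => //.
  move: spectrumH; apply: (@filterS _ _ (ae_filter_ringOfSetsType mu)) => t st.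
  rewrite /= -(mul0r (spectrum target t)); apply: cvgM; last exact: cvg_cst.
  under eq_fun do rewrite -muln2 mulnC exprM.
  apply: cvg_expr; have /andP[d0 d1] := damping01 t.
  rewrite ger0_norm ?exprn_ge0// expr_lt1// /damping gtrBl mulr_gt0//.
  by rewrite lt_neqAle eq_sym st spectrum_ge0.
pose K : R := \int[mu]_x (1 + x ^+ 2)^-1.
have K0 : 0 < K := cauchy_mass_gt0.
rewrite /Rintegral integral0/= in lim.
have /cvgrPdist_lt/(_ (K * e) (mulr_gt0 K0 e0))[n _ /(_ n (leqnn n))] := lim.
rewrite /= sub0r normrN => /(le_lt_trans (ler_norm _)) Qn.
have [f if_ fT] := landweber_iterate n; exists f => //.
pose r v := target v - corr f H v.
have ir : L1 r by apply: L1_sub; [exact: L1_target|exact: (corr_L1 if_ iH HM)].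
have sr : spectrum r = Q n.
  by apply/funext => t; rewrite /spectrum (fT t).1 (fT t).2 /Q /spectrum -mul2n mulnC exprM; ring.
have rM v : `|r v| <= 1 + M * \int[mu]_x `|f x|.
  by rewrite (le_trans (ler_normB _ _))// lerD ?target_le1// corr_le.
have cr x : x != 0 -> {for x, continuous r}.
  move=> x0; apply: cvgB; first exact: continuous_target.
  by apply: (@corr_continuous _ f H M 0 if_ mH HM) => y _; exact: cH.
have := plancherel_le ir rM cr; rewrite sr => /(_ (iQ n)).
rewrite -/K => /le_lt_trans/(_ Qn); rewrite ltr_pM2l// => /ltW; exact.
Qed.

End landweber.

(** * The span of the gamma kernels *)

Section laguerre_span.
Context {R : realType}.
Notation mu := (@lebesgue_measure R).
Notation L1 f := (mu.-integrable setT (EFin \o f)).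

(** This is x^(k + 1/2) e^(-p x) at x = e^v.  For p = 1 it is, up to a constant, the density of
    the Gamma(k + 1, 1) law in the logarithmic coordinate, multiplied by the factor e^(-v/2) that
    compensates for the normalization of Phi. *)
Definition gamma_kernel (k : nat) (p v : R) : R :=
  expR v ^+ k * (expR (v / 2) * expR (- (p * expR v))).

Lemma gamma_kernel_ge0 k p v : 0 <= gamma_kernel k p v.
Proof. by rewrite !mulr_ge0 ?exprn_ge0 ?expR_ge0. Qed.

Lemma continuous_gamma_kernel k p : continuous (gamma_kernel k p).
Proof.
have ce : continuous (@expR R) by exact: continuous_expR.
move=> v; apply: cvgM.
  apply: (@continuous_comp _ _ _ expR (fun x => x ^+ k)); first exact: ce.
  exact: exprn_continuous.
apply: cvgM; apply: continuous_comp; try exact: ce.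
  exact: mulrr_continuous.
apply: cvgN; apply: cvgM; [exact: cvg_cst|exact: ce].
Qed.

Lemma measurable_gamma_kernel k p : measurable_fun setT (gamma_kernel k p).
Proof. apply: continuous_measurable_fun; exact: continuous_gamma_kernel. Qed.

Definition gamma_kernel_bound (k : nat) (p : R) : R := 1 + k.+1`!%:R / p ^+ k.+1.

Lemma gamma_kernel_le k p v : 0 < p -> `|gamma_kernel k p v| <= gamma_kernel_bound k p * expR (- (2^-1 * `|v|)).
Proof.
move=> p0; rewrite ger0_norm ?gamma_kernel_ge0//.
have f0 : 0 <= k.+1`!%:R / p ^+ k.+1 by rewrite divr_ge0// exprn_ge0// ltW.
have [v0|v0] := leP v 0.
  rewrite ler0_norm// mulrN opprK (mulrC 2^-1).
  rewrite (_ : gamma_kernel k p v = expR v ^+ k * expR (- (p * expR v)) * expR (v / 2)); last by rewrite /gamma_kernel; ring.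
  rewrite ler_wpM2r ?expR_ge0//.
  apply: (@le_trans _ _ 1); last by rewrite lerDl.
  rewrite mulr_ile1 ?exprn_ge0 ?expR_ge0// ?exprn_ile1 ?expR_ge0 ?expR_le1//.
  by rewrite oppr_le0 mulr_ge0 ?expR_ge0// ltW.
rewrite gtr0_norm// expRN ler_pdivlMr ?expR_gt0//.
rewrite (_ : _ * _ = expR v ^+ k.+1 * expR (- (p * expR v))).
  rewrite expRN ler_pdivrMr ?expR_gt0//.
  rewrite (le_trans (exprn_le_expR k.+1 (expR_ge0 v) p0))//.
  by rewrite ler_wpM2r ?expR_ge0// lerDr.
have E : expR (v / 2) * expR (v / 2) = expR v by rewrite -expRD; congr expR; field.
transitivity (expR v ^+ k * (expR (v / 2) * expR (v / 2)) * expR (- (p * expR v))).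
  by rewrite /gamma_kernel (mulrC 2^-1); ring.
by rewrite E exprS; ring.
Qed.

Lemma L1_gamma_kernel k p : 0 < p -> L1 (gamma_kernel k p).
Proof.
move=> p0; have half0 : 0 < 2^-1 :> R by rewrite invr_gt0.
by apply: (@L1_le _ _ _ mu _ _ (measurable_gamma_kernel k p) (fun v => gamma_kernel_le k v p0)); exact/L1_scale/L1_expN.
Qed.

Lemma gamma_kernel_bounded k p v : 0 < p -> `|gamma_kernel k p v| <= gamma_kernel_bound k p.
Proof.
move=> p0; apply: (le_trans (gamma_kernel_le k v p0)); rewrite ler_piMr ?expR_le1 ?oppr_le0 ?mulr_ge0//.
by rewrite addr_ge0// divr_ge0// exprn_ge0// ltW.
Qed.

Definition approximable (F : R -> R) := forall e, 0 < e ->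
  exists n (c : nat -> R), \int[mu]_v `|F v - \sum_(i < n) c i * gamma_kernel i 1 v| <= e.

Lemma L1_span p n (c : nat -> R) k : 0 < p ->
  L1 (fun v => \sum_(i < n) c i * gamma_kernel (k + i) p v).
Proof.
move=> p0; have [] // := @Rintegral_sum _ _ (measurableTypeR R) mu (fun i v => c i * gamma_kernel (k + i) p v) n _.
by move=> i; apply: L1_scale; exact: L1_gamma_kernel.
Qed.

Lemma approximable_lim F : L1 F ->
  (forall e, 0 < e -> exists2 F', L1 F' /\ approximable F' & \int[mu]_v `|F v - F' v| <= e) ->
  approximable F.
Proof.
move=> iF FF' e e0; have e20 : 0 < e / 2 by rewrite divr_gt0.
have [F' [iF' aF'] FF'e] := FF' _ e20.
have [n [c F'c]] := aF' _ e20; exists n, c.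
have iS := @L1_span 1 n c 0 ltr01.
rewrite [leRHS]splitr; apply: le_trans (lerD FF'e F'c).
have i1 := integrable_norm (L1_sub iF iF'); have i2 := integrable_norm (L1_sub iF' iS).
rewrite -RintegralD//; apply: le_Rintegral => //.
- exact: (integrable_norm (L1_sub iF iS)).
- exact: L1_add.
- by move=> v _; rewrite -[X in `|X| <= _](subrKA (F' v)) ler_normD.
Qed.

Lemma approximable_add F1 F2 : L1 F1 -> L1 F2 -> approximable F1 -> approximable F2 ->
  approximable (fun v => F1 v + F2 v).
Proof.
move=> i1 i2 a1 a2 e e0; have e20 : 0 < e / 2 by rewrite divr_gt0.
have [n1 [c1 h1]] := a1 _ e20; have [n2 [c2 h2]] := a2 _ e20.
exists (n1 + n2)%N, (fun i => (i < n1)%:R * c1 i + (i < n2)%:R * c2 i).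
have iS1 := @L1_span 1 n1 c1 0 ltr01; have iS2 := @L1_span 1 n2 c2 0 ltr01.
have j1 := integrable_norm (L1_sub i1 iS1); have j2 := integrable_norm (L1_sub i2 iS2).
have E v : F1 v + F2 v - \sum_(i < n1 + n2) ((i < n1)%:R * c1 i + (i < n2)%:R * c2 i) * gamma_kernel i 1 v =
  (F1 v - \sum_(i < n1) c1 i * gamma_kernel i 1 v) + (F2 v - \sum_(i < n2) c2 i * gamma_kernel i 1 v).
  have trunc (n m : nat) (c : nat -> R) : (n <= m)%N ->
      \sum_(i < m) (i < n)%:R * c i * gamma_kernel i 1 v = \sum_(i < n) c i * gamma_kernel i 1 v.
    move=> nm; rewrite (big_ord_widen _ (fun i => c i * gamma_kernel i 1 v) nm) [RHS]big_mkcond/=.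
    by apply: eq_bigr => i _; case: ifP; rewrite ?mul1r ?mul0r.
  under eq_bigr do rewrite mulrDl.
  by rewrite big_split/= !trunc ?leq_addr ?leq_addl//; ring.
under eq_Rintegral do rewrite E.
rewrite [leRHS]splitr; apply: le_trans (lerD h1 h2); rewrite -RintegralD//.
apply: le_Rintegral => //.
- exact: (integrable_norm (L1_add (L1_sub i1 iS1) (L1_sub i2 iS2))).
- exact: L1_add.
- by move=> v _; exact: ler_normD.
Qed.

Lemma approximable_scale F k : L1 F -> approximable F -> approximable (fun v => k * F v).
Proof.
move=> iF aF e e0; have k0 : 0 < `|k| + 1 by rewrite ltr_wpDl.
have [n [c h]] := aF _ (divr_gt0 e0 k0); exists n, (fun i => k * c i).
have iS := @L1_span 1 n c 0 ltr01; have i1 := integrable_norm (L1_sub iF iS).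
have E v : `|k * F v - \sum_(i < n) k * c i * gamma_kernel i 1 v| =
    `|k| * `|F v - \sum_(i < n) c i * gamma_kernel i 1 v|.
  rewrite -normrM mulrBr mulr_sumr; congr `|_ - _|.
  by apply: eq_bigr => i _; rewrite -mulrA.
under eq_Rintegral do rewrite E.
rewrite RintegralZl// mulrC; move: h; rewrite ler_pdivlMr//; apply: le_trans.
by rewrite ler_wpM2l ?Rintegral_ge0// lerDl.
Qed.

Lemma approximable_span p n (c : nat -> R) k : 0 < p -> (forall i, approximable (gamma_kernel i p)) ->
  approximable (fun v => \sum_(i < n) c i * gamma_kernel (k + i) p v).
Proof.
move=> p0 aG; elim: n => [|n IH].
  move=> e e0; exists 0%N, (fun=> 0).
  under eq_Rintegral do rewrite !big_ord0 subrr normr0.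
  by rewrite /Rintegral integral0 ltW.
have -> : (fun v => \sum_(i < n.+1) c i * gamma_kernel (k + i) p v) =
    (fun v => \sum_(i < n) c i * gamma_kernel (k + i) p v + c n * gamma_kernel (k + n) p v).
  by apply/funext => v; rewrite big_ord_recr.
apply: approximable_add; [exact: L1_span|exact/L1_scale/L1_gamma_kernel|exact: IH|].
by apply: approximable_scale => //; exact: L1_gamma_kernel.
Qed.

Lemma geometric_small (th K e : R) : 0 <= th < 1 -> 0 < e -> exists N, th ^+ N * K <= e.
Proof.
move=> /andP[th0 th1] e0.
have lim : (fun N => th ^+ N * K) @ \oo --> (0 : R).
  rewrite -(mul0r K); apply: cvgM; last exact: cvg_cst.
  by apply: cvg_expr; rewrite ger0_norm.
have /cvgrPdist_lt/(_ e e0)[N _ /(_ N (leqnn N))] := lim.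
by rewrite /= sub0r normrN => /ltW h; exists N; exact: le_trans (ler_norm _) h.
Qed.

(** Write e^(-(3/2) p x) as e^(-p x) times the power series of e^(-(p/2) x), which converges in
    L^1 against e^(-p x). *)
Lemma approximable_kernel_step p : 0 < p -> (forall k, approximable (gamma_kernel k p)) ->
  forall k, approximable (gamma_kernel k (3 / 2 * p)).
Proof.
move=> p0 aG k; have q0 : 0 < 3 / 2 * p by rewrite mulr_gt0// divr_gt0.
have p40 : 0 < p / 4 by rewrite divr_gt0.
apply: approximable_lim; first exact: L1_gamma_kernel.
(* th = 2/3 leaves the remainder e^((p/2) x / th) = e^((3/4) p x), still dominated by e^(-p x) *)
move=> e e0; have th01 : 0 <= (2 / 3 : R) < 1 by lra.
have [N hN] := geometric_small (\int[mu]_v gamma_kernel k (p / 4) v) th01 e0.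
pose c i := (- (p / 2)) ^+ i / i`!%:R.
exists (fun v => \sum_(i < N) c i * gamma_kernel (k + i) p v).
  by split; [exact: L1_span|exact: approximable_span].
apply: le_trans hN; rewrite -RintegralZl//; last exact: L1_gamma_kernel.
apply: le_Rintegral => //.
- exact: (integrable_norm (L1_sub (L1_gamma_kernel k q0) (L1_span N c k p0))).
- exact: (L1_scale _ (L1_gamma_kernel k p40)).
move=> v _; pose x := expR v; pose z := - (p / 2) * x.
have -> : gamma_kernel k (3 / 2 * p) v - \sum_(i < N) c i * gamma_kernel (k + i) p v =
    gamma_kernel k p v * (expR z - \sum_(i < N) z ^+ i / i`!%:R).
  rewrite mulrBr mulr_sumr; congr (_ - _).
    rewrite /gamma_kernel (_ : - (3 / 2 * p * expR v) = - (p * expR v) + z); last by rewrite /z /x; field.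
    by rewrite expRD; ring.
  by apply: eq_bigr => i _; rewrite /gamma_kernel /c /z exprMn exprD; ring.
have th01' : 0 < (2 / 3 : R) <= 1 by lra.
rewrite normrM ger0_norm ?gamma_kernel_ge0//.
apply: (le_trans (ler_wpM2l (gamma_kernel_ge0 _ _ _) (expR_tail_le z N th01'))).
rewrite mulrCA ler_wpM2l ?exprn_ge0 ?divr_ge0//.
rewrite /z normrM normrN !gtr0_norm ?expR_gt0 ?divr_gt0// /gamma_kernel.
rewrite (_ : - (p / 4 * expR v) = - (p * expR v) + p / 2 * x / (2 / 3)); last by rewrite /x; field.
by rewrite expRD le_eqVlt; apply/orP; left; apply/eqP; ring.
Qed.

(** A single expansion around the rate 1 converges only for rates below 2; iterated
    expansions reach arbitrarily large rates. *)
Lemma approximable_kernel_pow m k : approximable (gamma_kernel k ((3 / 2) ^+ m)).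
Proof.
elim: m k => [|m IH] k; last first.
  by rewrite exprS; apply: approximable_kernel_step => //; rewrite exprn_gt0// divr_gt0.
rewrite expr0 => e e0; exists k.+1, (fun i => (i == k)%:R).
rewrite (_ : \int[mu]_v _ = 0) ?ltW//.
under eq_Rintegral.
  move=> v _; rewrite big_ord_recr/= eqxx mul1r big1 ?add0r ?subrr ?normr0; last first.
    by move=> i _; rewrite ltn_eqF ?mul0r.
  over.
by rewrite /Rintegral integral0.
Qed.

End laguerre_span.

(** * Convolutions with a gamma kernel *)

Section density_of_span.
Context {R : realType}.
Notation mu := (@lebesgue_measure R).
Notation L1 f := (mu.-integrable setT (EFin \o f)).

Lemma convol_L1r (f g : R -> R) M v : L1 f -> measurable_fun setT g ->
  (forall x, `|g x| <= M) -> L1 (fun x => f x * g (v - x)).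
Proof.
move=> if_ mg gM; apply: (@L1_mulr _ _ _ _ _ _ M) => //.
by apply: measurableT_comp => //; exact: measurable_funB.
Qed.

Lemma convol_norm_le (f g : R -> R) M : L1 f -> L1 g -> (forall x, `|g x| <= M) ->
  \int[mu]_v `|convol f g v| <= (\int[mu]_x `|f x|) * \int[mu]_x `|g x|.
Proof.
move=> if_ ig gM; have jf := integrable_norm if_; have jg := integrable_norm ig.
have mg := L1_measurable ig.
have gM' x : `| `|g x| | <= M by rewrite normr_id.
have c1 (v : R) : `|(cst 1 : R -> R) v| <= 1 by rewrite normr1.
have [_] := convol_pairing jf jg gM' (measurable_cst _) c1.
under eq_Rintegral do rewrite mulr1.
under [RHS]eq_Rintegral do under eq_Rintegral do rewrite mulr1.
rewrite RintegralZr// => <-; apply: le_Rintegral => //.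
- exact: (integrable_norm (convol_L1 if_ ig gM)).
- exact: convol_L1 jf jg gM'.
move=> v _; apply: le_norm_Rintegral; first exact: convol_L1r gM.
  by apply: (convol_L1r v jf _ gM'); exact: measurableT_comp.
by move=> x; rewrite normrM.
Qed.

(** The convolution is a mixture over |y| <= m of the exponentials e^(-x e^(-y)).  Once p exceeds
    e^m, all the rates e^(-y) lie between e^(-m) and p, so that the expansions around e^(-p x)
    converge uniformly in y and can be integrated against [f]. *)
Lemma approximable_convol_supported (f : R -> R) (m : R) : 0 <= m -> L1 f ->
  (forall y, m < `|y| -> f y = 0) -> approximable (convol f (gamma_kernel 0 1)).
Proof.
move=> m0 if_ fm; have mf := L1_measurable if_.
have iG1 := @L1_gamma_kernel R 0 1 ltr01.
have GM (x : R) : `|gamma_kernel 0 1 x| <= gamma_kernel_bound 0 1 by exact: gamma_kernel_bounded.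
have [n np] : exists n, expR m <= (3 / 2 : R) ^+ n.
  have th : 0 <= (2 / 3 : R) < 1 by lra.
  have [n] := geometric_small (expR m) th ltr01; exists n.
  rewrite (_ : 2 / 3 = (3 / 2)^-1) in p; last by field.
  by move: p; rewrite exprVn mulrC ler_pdivrMr ?mul1r// exprn_gt0// divr_gt0.
set p := (3 / 2) ^+ n in np.
have aG k : approximable (gamma_kernel k p) by exact: approximable_kernel_pow.
have p0 : 0 < p by apply: lt_le_trans np; exact: expR_gt0.
pose r := p - expR (- m).
have r0 : 0 <= r.
  by rewrite subr_ge0 (le_trans _ np)// ler_expR (le_trans _ m0)// oppr_le0.
have rp : r < p by rewrite ltrBlDr ltrDl expR_gt0.
(* chosen so that r / th < p: the remainder e^((r / th) x) is still dominated by e^(-p x) *)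
pose th := (p + r) / (2 * p).
have pr0 : 0 < p + r by rewrite ltr_wpDr.
have th0 : 0 < th by rewrite divr_gt0// mulr_gt0.
have th1 : th < 1 by rewrite ltr_pdivrMr ?mulr_gt0// mul1r mulr_natl mulr2n ltrD2l.
have thle : 0 < th <= 1 by rewrite th0 ltW.
have thlt : 0 <= th < 1 by rewrite th1 ltW.
pose p' := p - r / th.
have p'0 : 0 < p'.
  rewrite subr_gt0 ltr_pdivrMr// /th mulrA ltr_pdivlMr ?mulr_gt0//.
  nra.
pose q y := p - expR (- y).
have qr y : `|y| <= m -> `|q y| <= r.
  rewrite ler_norml => /andP[ym my].
  rewrite ger0_norm /q.
    by rewrite lerD2l lerN2 ler_expR lerN2.
  by rewrite subr_ge0 (le_trans _ np)// ler_expR lerNl.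
have mq : measurable_fun setT q.
  by apply: measurable_funB => //; apply: measurableT_comp => //; exact: oppr_measurable.
pose e2 (y : R) : R := expR (- y / 2).
have me2 : measurable_fun setT e2.
  apply: measurableT_comp => //; apply: measurable_funM => //; exact: oppr_measurable.
have e2m y : `|y| <= m -> e2 y <= expR (m / 2).
  by rewrite ler_norml => /andP[ym my]; rewrite ler_expR ler_wpM2r// lerNl.
have iw i : L1 (fun y => f y * (e2 y * q y ^+ i)).
  apply: (@L1_le _ _ _ mu _ (fun y : R => (expR (m / 2) * r ^+ i) * `|f y|)).
  - by apply: measurable_funM => //; apply: measurable_funM => //; exact: measurable_funX.
  - move=> y; have [ym|/fm ->] := leP `|y| m; last by rewrite mul0r normr0 mulr0.
    rewrite normrM mulrC ler_wpM2r// normrM normrX ler_pM ?exprn_ge0//.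
      by rewrite ger0_norm ?expR_ge0 ?e2m.
    by rewrite lerXn2r ?nnegrE ?qr.
  - by apply: L1_scale; exact: integrable_norm.
apply: approximable_lim; first exact: convol_L1 if_ iG1 GM.
move=> e e0.
pose K := expR (m / 2) * (\int[mu]_y `|f y|).
have [N hN] := geometric_small (K * \int[mu]_v gamma_kernel 0 p' v) thlt e0.
pose c i := (\int[mu]_y (f y * (e2 y * q y ^+ i))) / i`!%:R.
exists (fun v => \sum_(i < N) c i * gamma_kernel (0 + i) p v).
  by split; [exact: L1_span|exact: approximable_span].
apply: le_trans hN; rewrite mulrA -RintegralZl//; last exact: L1_gamma_kernel.
apply: le_Rintegral => //.
- exact: (integrable_norm (L1_sub (convol_L1 if_ iG1 GM) (L1_span N c 0 p0))).
- exact/L1_scale/L1_gamma_kernel.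
move=> v _; pose x := expR v.
pose F i (y : R) : R := (f y * (e2 y * q y ^+ i)) * (gamma_kernel i p v / i`!%:R).
have iF i : L1 (F i).
  exact: (integrableZr measurableT (gamma_kernel i p v / i`!%:R) (iw i)).
have [iS SE] := Rintegral_sum N iF.
have -> : \sum_(i < N) c i * gamma_kernel (0 + i) p v = \int[mu]_y \sum_(i < N) F i y.
  rewrite SE; apply: eq_bigr => i _; rewrite RintegralZr//.
  by rewrite /c add0n -mulrA (mulrC (_^-1)).
have icv := convol_L1r v if_ (L1_measurable iG1) GM.
rewrite -RintegralB//.
rewrite (_ : _ * _ * _ = (expR (m / 2) * th ^+ N * gamma_kernel 0 p' v) * \int[mu]_y `|f y|); last first.
  by rewrite /K; ring.
rewrite -RintegralZl//; last exact: integrable_norm.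
apply: le_norm_Rintegral.
- exact: (L1_sub icv iS).
- by apply: L1_scale; exact: integrable_norm.
move=> y.
have [ym|/fm f0] := leP `|y| m; last first.
  rewrite f0 mul0r normr0 mulr0 sub0r normrN big1 ?normr0//.
  by move=> i _; rewrite /F f0 !mul0r.
pose z := q y * x.
have -> : f y * gamma_kernel 0 1 (v - y) - \sum_(i < N) F i y =
    f y * (e2 y * gamma_kernel 0 p v * (expR z - \sum_(i < N) z ^+ i / i`!%:R)).
  have -> : gamma_kernel 0 1 (v - y) = e2 y * gamma_kernel 0 p v * expR z.
    rewrite /gamma_kernel !expr0 !mul1r /e2.
    rewrite (_ : (v - y) / 2 = - y / 2 + v / 2); last by field.
    rewrite (_ : - expR (v - y) = - (p * expR v) + z); last by rewrite /z /q /x expRD; ring.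
    by rewrite !expRD; ring.
  rewrite mulrBr (mulrBr (f y)); congr (_ - _).
  rewrite !mulr_sumr; apply: eq_bigr => i _; rewrite /F /gamma_kernel expr0 /z /x exprMn; ring.
rewrite normrM mulrC ler_wpM2r// normrM (ger0_norm (_ : 0 <= e2 y * _)); last first.
  by rewrite mulr_ge0 ?gamma_kernel_ge0 ?expR_ge0.
apply: (@le_trans _ _ (e2 y * gamma_kernel 0 p v * (th ^+ N * expR (r / th * x)))).
  rewrite ler_wpM2l ?mulr_ge0 ?gamma_kernel_ge0 ?expR_ge0// (le_trans (expR_tail_le z N thle))//.
  rewrite ler_wpM2l ?exprn_ge0 ?(ltW th0)// ler_expR mulrAC ler_wpM2r ?invr_ge0 ?(ltW th0)//.
  by rewrite /z normrM (ger0_norm (expR_ge0 v)) ler_wpM2r ?expR_ge0 ?qr.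
rewrite (_ : _ * _ * _ = e2 y * (th ^+ N * gamma_kernel 0 p' v)).
  by rewrite -mulrA ler_wpM2r ?e2m// mulr_ge0 ?gamma_kernel_ge0// exprn_ge0// ltW.
rewrite /gamma_kernel /p' (_ : - ((p - r / th) * expR v) = - (p * expR v) + r / th * x); last by rewrite /x; ring.
by rewrite expRD; ring.
Qed.

(** Cutting off [f] at infinity costs little in L^1, and convolution with a fixed kernel is
    bounded on L^1. *)
Lemma approximable_convol (f : R -> R) : L1 f -> approximable (convol f (gamma_kernel 0 1)).
Proof.
move=> if_; have mf := L1_measurable if_.
have iG1 := @L1_gamma_kernel R 0 1 ltr01.
have GM (x : R) : `|gamma_kernel 0 1 x| <= gamma_kernel_bound 0 1 by exact: gamma_kernel_bounded.
apply: approximable_lim; first exact: convol_L1 if_ iG1 GM.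
move=> e e0; set K := \int[mu]_x `|gamma_kernel 0 1 x|.
have K0 : 0 <= K by exact: Rintegral_ge0.
pose I n : set R := `[- (n%:R : R), n%:R]%classic.
have mI n : measurable_fun setT (\1_(I n) : R -> R) by apply: measurable_indic; exact: measurable_itv.
pose fc n (x : R) := f x * \1_(I n) x.
have ifc n : L1 (fc n).
  apply: (@L1_mulr _ _ _ mu _ _ 1 if_ (mI n)) => x.
  by rewrite indicE; case: (_ \in _); rewrite ?normr1 ?normr0.
have Iout n x : n%:R < `|x| -> \1_(I n) x = 0 :> R.
  move=> nx; rewrite indicE memNset// /I /= in_itv/= -ler_norml.
  by apply/negP; rewrite -ltNge.
have Iin n x : `|x| <= n%:R -> \1_(I n) x = 1 :> R.
  by move=> nx; rewrite indicE mem_set// /I /= in_itv/= -ler_norml.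
have lim : (fun n => \int[mu]_x `|f x - fc n x|) @ \oo --> \int[mu]_x (cst 0 x : R).
  apply: (@Rdominated_cvg _ _ _ mu _ _ (fun x => `|f x|)).
  - move=> n; apply: measurableT_comp => //; apply: measurable_funB => //; exact: L1_measurable (ifc n).
  - exact: measurable_cst.
  - apply: aeW => x; apply: cvg_near_cst; near=> n.
    have xn : `|x| <= n%:R by near: n; exact: nbhs_infty_ger.
    by rewrite /fc Iin// mulr1 subrr normr0.
  - exact: integrable_norm.
  - move=> n x; rewrite normr_id /fc; have [xn|xn] := leP `|x| n%:R.
      by rewrite Iin// mulr1 subrr normr0.
    by rewrite Iout// mulr0 subr0.
rewrite /Rintegral integral0/= in lim.
have K1 : 0 < K + 1 by rewrite ltr_wpDl.
have /cvgrPdist_lt/(_ _ (divr_gt0 e0 K1))[n _ /(_ n (leqnn n))] := lim.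
rewrite /= sub0r normrN => /(le_lt_trans (ler_norm _)) fn.
exists (convol (fc n) (gamma_kernel 0 1)).
  split; first exact: convol_L1 (ifc n) iG1 GM.
  apply: (@approximable_convol_supported _ n%:R) => // y ny.
  by rewrite /fc Iout// mulr0.
under eq_Rintegral.
  move=> v _; rewrite -RintegralB//; [|by apply: (convol_L1r v _ _ GM) => //; exact: measurable_gamma_kernel..].
  under eq_Rintegral do rewrite -mulrBl.
  over.
apply: (le_trans (convol_norm_le (L1_sub if_ (ifc n)) iG1 GM)).
rewrite -/K; move: fn; rewrite ltr_pdivlMr// => /ltW; apply: le_trans.
by rewrite ler_wpM2l ?lerDl// Rintegral_ge0.
Unshelve. all: by end_near. Qed.

End density_of_span.

(** * Approximation of the target by correlations *)

Section completeness.
Context {R : realType}.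
Notation mu := (@lebesgue_measure R).
Notation L1 f := (mu.-integrable setT (EFin \o f)).

Variables (Phi : R -> R) (C : R).
Hypothesis mPhi : measurable_fun setT Phi.
Hypothesis PhiC : forall u, `|Phi u| <= C * expR (- (2^-1 * `|u|)).
Hypothesis intPhi : \int[mu]_u Phi u != 0.

Let half0 : 0 < 2^-1 :> R. Proof. by rewrite invr_gt0. Qed.

Let C0 : 0 <= C.
Proof.
by have := le_trans (normr_ge0 _) (PhiC 0); rewrite normr0 mulr0 oppr0 expR0 mulr1.
Qed.

Let iPhi : L1 Phi.
Proof. exact: (@L1_le _ _ _ mu _ _ mPhi PhiC (L1_scale C (L1_expN half0))). Qed.

Let PhiM u : `|Phi u| <= C.
Proof.
by rewrite (le_trans (PhiC u))// ler_piMr// expR_le1 oppr_le0 mulr_ge0// ltW.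
Qed.

Let iG1 : L1 (gamma_kernel 0 1 : R -> R). Proof. exact: L1_gamma_kernel. Qed.

Let H := corr (gamma_kernel 0 1) Phi.

Let iH : L1 H. Proof. exact: corr_L1 iG1 iPhi PhiM. Qed.

(** [Phi] may jump, so continuity is obtained from the other factor, after exchanging the roles
    of the two functions. *)
Let continuous_H : continuous H.
Proof.
have HE : H = (corr Phi (gamma_kernel 0 1)) \o -%R.
  apply/funext => u; rewrite /H /corr /= -[RHS](Rintegral_shift u).
    by apply: eq_Rintegral => x _; rewrite addrK mulrC.
  apply: measurable_funM => //; apply: measurableT_comp; first exact: measurable_gamma_kernel.
  exact: measurable_funD.
have cc : continuous (corr Phi (gamma_kernel 0 1)).
  apply: (@corr_continuous _ _ _ (gamma_kernel_bound 0 1) 0 iPhi (measurable_gamma_kernel 0 1)).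
    by move=> x; exact: gamma_kernel_bounded.
  by move=> x _; exact: continuous_gamma_kernel.
by rewrite HE => u; apply: continuous_comp; [exact: oppr_continuous|exact: cc].
Qed.

Let H_decay u : `|H u| <=
  (C * gamma_kernel_bound 0 1 * \int[mu]_v expR (- (4^-1 * `|v|))) * expR (- (4^-1 * `|u|)).
Proof.
have q0 : 0 < 4^-1 :> R by rewrite invr_gt0.
rewrite mulrAC -RintegralZl//; last exact: L1_expN.
apply: le_norm_Rintegral; [exact: corr_L1r iG1 iPhi PhiM _|exact/L1_scale/L1_expN|].
move=> v; rewrite normrM.
apply: (le_trans (ler_pM (normr_ge0 _) (normr_ge0 _) (gamma_kernel_le 0 v ltr01) (PhiC (v + u)))).
have G0 : 0 <= gamma_kernel_bound 0 1 :> R by rewrite addr_ge0// divr_ge0// exprn_ge0.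
rewrite (_ : _ * _ * _ = C * gamma_kernel_bound 0 1 * (expR (- (2^-1 * `|v|)) * expR (- (2^-1 * `|v + u|)))); last by ring.
rewrite [leRHS](_ : _ = C * gamma_kernel_bound 0 1 * (expR (- (4^-1 * `|u|)) * expR (- (4^-1 * `|v|)))); last by ring.
rewrite ler_wpM2l ?mulr_ge0// -!expRD ler_expR.
have : `|u| <= `|v| + `|v + u|.
  by rewrite -[X in `|X| <= _](addKr v) (le_trans (ler_normD _ _))// normrN.
by have := normr_ge0 (v + u); lra.
Qed.

Let intG_gt0 : 0 < \int[mu]_v (gamma_kernel 0 1 v : R).
Proof.
pose k : R := expR (- 2^-1 - 1).
have iI : L1 (\1_(`[-1, 0] : set R) : R -> R) by exact: integrable_indic_itv.
apply: (@lt_le_trans _ _ (\int[mu]_v (k * \1_(`[-1, 0] : set R) v))).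
  rewrite RintegralZl// mulr_gt0 ?expR_gt0// /Rintegral integral_indic//= setIT lebesgue_measure_itv/=.
  by rewrite lte_fin ltrN10/= opprK add0r.
apply: le_Rintegral => //; first exact: L1_scale.
move=> x _; rewrite indicE; have [|_] := boolP (x \in _); last by rewrite mulr0 gamma_kernel_ge0.
rewrite inE/= in_itv/= => /andP[x1 x0]; rewrite mulr1 /gamma_kernel expr0 mul1r mul1r -expRD ler_expR.
by have : expR x <= 1; [rewrite expR_le1|lra].
Qed.

Let intH : \int[mu]_u H u != 0.
Proof.
have c1 (v : R) : `|(cst 1 : R -> R) v| <= 1 by rewrite normr1.
have [_] := corr_pairing iG1 iPhi PhiM (measurable_cst _) c1.
under eq_Rintegral do rewrite mulr1.
under [RHS]eq_Rintegral do under eq_Rintegral do rewrite mulr1.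
by rewrite RintegralZr// => ->; rewrite mulf_neq0// gt_eqF.
Qed.

Lemma corr_span n (c : nat -> R) v :
  corr (fun x => \sum_(i < n) c i * gamma_kernel (0 + i) 1 x) Phi v = \sum_(i < n) c i * corr (gamma_kernel i 1) Phi v.
Proof.
have iF i : L1 (fun x => c i * (gamma_kernel i 1 x * Phi (x + v))).
  by apply: L1_scale; exact: corr_L1r (@L1_gamma_kernel R i 1 ltr01) iPhi PhiM _.
have [_ E] := Rintegral_sum n iF.
transitivity (\int[mu]_x \sum_(i < n) c i * (gamma_kernel i 1 x * Phi (x + v))).
  apply: eq_Rintegral => x _; rewrite mulr_suml; apply: eq_bigr => i _.
  by rewrite add0n mulrA.
rewrite E; apply: eq_bigr => i _; rewrite RintegralZl//.
exact: corr_L1r (@L1_gamma_kernel R i 1 ltr01) iPhi PhiM _.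
Qed.

(** Landweber's iteration provides an integrable f such that corr f H, which is
    corr (f * g) Phi for the kernel g with k = 0, is close to the target.  Replacing f * g by a
    combination of kernels close to it in L^1 changes the correlation little in L^2. *)
Lemma target_approximation (e : R) : 0 < e -> exists n (c : nat -> R),
  let r v := (target v - \sum_(i < n) c i * corr (gamma_kernel i 1) Phi v) ^+ 2 in
  L1 r /\ \int[mu]_v r v <= e.
Proof.
move=> e0; have e40 : 0 < e / 4 by rewrite divr_gt0.
have mH := L1_measurable iH.
have q0 : 0 < 4^-1 :> R by rewrite invr_gt0.
have HM := corr_le iG1 iPhi PhiM; rewrite -/H in HM.
have sH := spectrum_neq0_ae mH q0 H_decay intH.
have [f if_ fe] := landweber continuous_H iH HM sH e40.
have GM (x : R) : `|gamma_kernel 0 1 x| <= gamma_kernel_bound 0 1 by exact: gamma_kernel_bounded.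
set g := convol f (gamma_kernel 0 1).
have ig : L1 g by exact: convol_L1 if_ iG1 GM.
have fHE v : corr f H v = corr g Phi v by exact: (corr_corr if_ iG1 GM v mPhi PhiM).
pose B := \int[mu]_x Phi x ^+ 2.
have B0 : 0 <= B by apply: Rintegral_ge0 => x _; exact: sqr_ge0.
pose d := Num.min 1 (e / 4 / (B + 1)).
have B10 : 0 < B + 1 by rewrite ltr_wpDl.
have d0 : 0 < d by rewrite lt_min ltr01 divr_gt0.
have [n [c gc]] := approximable_convol if_ d0.
exists n, c => /=.
pose s x := \sum_(i < n) c i * gamma_kernel (0 + i) 1 x.
have i_s : L1 s by exact: L1_span.
pose r1 v := target v - corr f H v.
pose r2 := corr (fun x => g x - s x) Phi.
have igs : L1 (fun x => g x - s x) by exact: L1_sub.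
have r1M v : `|r1 v| <= 1 + (C * \int[mu]_x `|gamma_kernel 0 1 x|) * \int[mu]_x `|f x|.
  by rewrite (le_trans (ler_normB _ _))// lerD ?target_le1// (corr_le if_ iH HM).
have ir1 : L1 r1.
  by apply: L1_sub; [exact: L1_target|exact: (corr_L1 if_ iH HM)].
have ir2 : L1 r2 by exact: corr_L1 igs iPhi PhiM.
have rE v : target v - \sum_(i < n) c i * corr (gamma_kernel i 1) Phi v = r1 v + r2 v.
  rewrite -corr_span -/s /r1 /r2 fHE /corr.
  under [X in _ = _ + X]eq_Rintegral do rewrite mulrBl.
  rewrite RintegralB//; [|exact: corr_L1r PhiM _..].
  by rewrite addrA subrK.
have ir12 := L1_sqr ir1 r1M.
have ir22 : L1 (fun v => r2 v ^+ 2) by exact: L1_sqr ir2 (corr_le igs iPhi PhiM).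
have -> : (fun v => (target v - \sum_(i < n) c i * corr (gamma_kernel i 1) Phi v) ^+ 2) =
    (fun v => (r1 v + r2 v) ^+ 2) by apply/funext => v; rewrite rE.
have rle v : (r1 v + r2 v) ^+ 2 <= 2 * r1 v ^+ 2 + 2 * r2 v ^+ 2.
  by rewrite -subr_ge0 (_ : _ - _ = (r1 v - r2 v) ^+ 2) ?sqr_ge0//; ring.
have ib : L1 (fun v => 2 * r1 v ^+ 2 + 2 * r2 v ^+ 2).
  by apply: L1_add; exact: L1_scale.
have ir : L1 (fun v => (r1 v + r2 v) ^+ 2).
  apply: (@L1_le _ _ _ mu _ _ _ _ ib).
    by apply: measurable_funX; exact: L1_measurable (L1_add ir1 ir2).
  by move=> v; rewrite ger0_norm ?sqr_ge0.
split => //.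
apply: (@le_trans _ _ (\int[mu]_v (2 * r1 v ^+ 2 + 2 * r2 v ^+ 2))).
  exact: le_Rintegral.
rewrite RintegralD//; [|exact: L1_scale..].
rewrite !RintegralZl//.
have r2e : \int[mu]_v r2 v ^+ 2 <= e / 4.
  apply: (le_trans (young_sqr igs iPhi PhiM)).
  apply: (@le_trans _ _ (d * B)).
    rewrite ler_wpM2r// expr2; apply: (@le_trans _ _ (d * 1)); last by rewrite mulr1.
    have g0 : 0 <= \int[mu]_x `|g x - s x| by exact: Rintegral_ge0.
    by rewrite ler_pM// (le_trans gc)// ge_min lexx.
  apply: (@le_trans _ _ (e / 4 / (B + 1) * (B + 1))); last by rewrite divfK// gt_eqF.
  apply: ler_pM => //; first exact: ltW.
    by rewrite ge_min lexx orbT.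
  by rewrite lerDl.
by move: fe r2e; rewrite -/r1; lra.
Qed.

End completeness.

(** * Expected fractional parts *)

Section fractional_part.
Context {R : realType}.
Implicit Types x y : R.

Lemma frac_part_ge0 y : 0 <= frac_part y.
Proof. by rewrite /frac_part subr_ge0 floor_le. Qed.

Lemma frac_part_lt1 y : frac_part y < 1.
Proof.
by rewrite /frac_part ltrBlDr addrC; have /andP[_] := floor_itv y; rewrite intrD.
Qed.

Lemma frac_part_le y : 0 <= y -> frac_part y <= y.
Proof. by move=> y0; rewrite /frac_part gerBl ler0z floor_ge0. Qed.

Lemma frac_part_id y : 0 <= y < 1 -> frac_part y = y.
Proof. by move=> y01; rewrite /frac_part (@floor_def _ y 0) ?subr0. Qed.

Lemma measurable_frac_part : measurable_fun setT (@frac_part R).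
Proof.
apply: measurable_funB => //; apply: nondecreasing_measurable => //.
by move=> x y xy; rewrite ler_int; exact: le_floor.
Qed.

Lemma measurable_invr : measurable_fun setT (@GRing.inv R).
Proof.
have -> : [set: R] = `]-oo, 0[%classic `|` [set 0] `|` `]0, +oo[%classic.
  apply/seteqP; split => // x _; rewrite /= !in_itv/= andbT.
  by have [x0|x0|x0] := ltrgtP x 0; [left; left|right|left; right].
have c (x : R) : x != 0 -> {for x, continuous (@GRing.inv R)} by exact: inv_continuous.
apply/measurable_funU => //; first exact: measurableU.
split; last first.
  apply: open_continuous_measurable_fun => // x; rewrite inE/= in_itv/= andbT => x0.
  by apply: c; rewrite gt_eqF.
apply/measurable_funU => //; split; last exact: measurable_fun_set1.
apply: open_continuous_measurable_fun => // x; rewrite inE/= in_itv/= => x0.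
by apply: c; rewrite lt_eqF.
Qed.

End fractional_part.

Section expected_fraction.
Context d (T : measurableType d) (R : realType) (P : probability T R).
Notation mu := (@lebesgue_measure R).
Notation L1 f := (mu.-integrable setT (EFin \o f)).

Lemma measurable_frac_div (Z : T -> R) : measurable_fun setT Z ->
  measurable_fun setT (fun z : T * R => (frac_part (Z z.1 / z.2))%:E).
Proof.
move=> mZ; apply/measurable_EFinP; apply: measurableT_comp; first exact: measurable_frac_part.
apply: measurable_funM; first exact: (measurableT_comp mZ (@measurable_fst _ _ _ _)).
exact: (measurableT_comp measurable_invr (@measurable_snd _ _ _ _)).
Qed.

Lemma integrable_frac_div (Z : T -> R) s : measurable_fun setT Z ->
  P.-integrable setT (EFin \o (fun w => frac_part (Z w / s))).
Proof.
move=> mZ; apply: (@L1_le _ _ _ P _ (cst 1)).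
- apply: measurableT_comp; first exact: measurable_frac_part.
  exact: measurable_funM.
- by move=> w; rewrite ger0_norm ?frac_part_ge0// ltW// frac_part_lt1.
- by apply: finite_measure_integrable_cst.
Qed.

Lemma EFin_hmul (Z : T -> R) s : measurable_fun setT Z ->
  (hmul P Z s)%:E = (\int[P]_w (frac_part (Z w / s))%:E)%E.
Proof.
move=> mZ; rewrite /hmul unlock fineK//.
exact: (integrable_fin_num measurableT (integrable_frac_div s mZ)).
Qed.

Lemma measurable_hmul (Z : T -> R) : measurable_fun setT Z -> measurable_fun setT (hmul P Z).
Proof.
move=> mZ; apply/measurable_EFinP.
have := measurable_fun_fubini_tonelli_G (m1 := P) _ (measurable_frac_div mZ).
move=> /(_ (fun z => ltac:(by rewrite lee_fin frac_part_ge0))).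
by apply: eq_measurable_fun => s _; rewrite /fubini_G/= -EFin_hmul.
Qed.

Lemma hmul_ge0 (Z : T -> R) s : 0 <= hmul P Z s.
Proof.
by rewrite /hmul unlock fine_ge0// integral_ge0// => w _; rewrite lee_fin frac_part_ge0.
Qed.

Lemma hmul_le1 (Z : T -> R) s : measurable_fun setT Z -> hmul P Z s <= 1.
Proof.
move=> mZ; rewrite -lee_fin EFin_hmul//.
rewrite -[leRHS](@probability_setT _ _ _ P) -[leRHS]mul1e -integral_cst//.
apply: ge0_le_integral => //.
- by move=> w _; rewrite lee_fin frac_part_ge0.
- exact: (measurable_int P (integrable_frac_div s mZ)).
- by move=> w _; rewrite lee_fin ltW// frac_part_lt1.
Qed.

Variable Y : {RV P >-> R}.
Hypothesis Y_gt0 : {ae P, forall w, 0 < Y w}.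
Hypothesis Y_int : P.-integrable setT (EFin \o Y).

Let mY : measurable_fun setT Y. Proof. exact: measurable_funPT. Qed.

Let phi := hmul P Y.

Let mean := \int[P]_w `|Y w|.

Lemma hmul_le_mean s : 0 < s -> phi s <= mean / s.
Proof.
move=> s0; rewrite -lee_fin EFin_hmul//.
have iY : P.-integrable setT (EFin \o (fun w => s^-1 * `|Y w|)).
  by apply: L1_scale; exact: (integrable_norm Y_int).
rewrite (_ : mean / s = \int[P]_w (s^-1 * `|Y w|)); last first.
  by rewrite RintegralZl// 1?mulrC//; exact: (integrable_norm Y_int).
rewrite -L1_EFin_Rintegral//.
apply: ae_ge0_le_integral => //.
- by move=> w _; rewrite lee_fin frac_part_ge0.
- exact: (measurable_int P (integrable_frac_div s mY)).
- by move=> w _; rewrite lee_fin mulr_ge0// invr_ge0 ltW.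
- exact: measurable_int iY.
- move: Y_gt0; apply: filterS => w Yw _.
  rewrite lee_fin (gtr0_norm Yw) [leRHS]mulrC; apply: frac_part_le.
  by rewrite divr_ge0// ltW.
Qed.

(** If phi s were 0, the fractional part of Y / s would vanish almost surely.  On the event Y < s
    it equals Y / s, which is positive; hence Y >= s almost surely, against mean < s. *)
Lemma hmul_gt0 s : mean < s -> 0 < phi s.
Proof.
move=> ms; have s0 : 0 < s by apply: le_lt_trans ms; exact: Rintegral_ge0.
rewrite lt_neqAle hmul_ge0 andbT eq_sym; apply/negP => /eqP phi0.
have : (\int[P]_w `|(frac_part (Y w / s))%:E| = 0)%E.
  under eq_integral do rewrite gee0_abs ?lee_fin ?frac_part_ge0//.
  by rewrite -EFin_hmul// -/phi phi0.
have mfr : measurable_fun setT (fun w => (frac_part (Y w / s))%:E).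
  exact: (measurable_int P (integrable_frac_div s mY)).
move=> /(ae_eq_integral_abs P measurableT mfr) fr0.
suff : s <= mean by rewrite leNgt ms.
have sY : {ae P, forall w, setT w -> (s%:E <= `|Y w|%:E)%E}.
  near=> w => _; rewrite lee_fin leNgt; apply/negP.
  have Yw : 0 < Y w by near: w.
  rewrite gtr0_norm// => Yws.
  have frw : (frac_part (Y w / s))%:E = 0%E by near: w; move: fr0; apply: filterS => ? /(_ I).
  move: frw; rewrite frac_part_id; last first.
    by rewrite divr_ge0 ?(ltW Yw) ?(ltW s0)//= ltr_pdivrMr// mul1r.
  by move=> [] /eqP; rewrite mulf_eq0 invr_eq0 !gt_eqF.
rewrite -lee_fin -[leLHS]mule1 -(@probability_setT _ _ _ P) -integral_cst//.
have iY := integrable_norm Y_int.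
rewrite /mean -L1_EFin_Rintegral//.
apply: ae_ge0_le_integral => //.
- by move=> w _; rewrite lee_fin ltW.
- exact: measurable_int iY.
Unshelve. all: by end_near. Qed.

Lemma hmul_expR_decay u :
  `|expR (u / 2) * phi (expR u)| <= (1 + mean) * expR (- (2^-1 * `|u|)).
Proof.
have mean0 : 0 <= mean by exact: Rintegral_ge0.
rewrite ger0_norm ?mulr_ge0 ?expR_ge0 ?hmul_ge0//.
have [u0|u0] := leP u 0.
  rewrite ler0_norm// mulrN opprK (mulrC 2^-1) [leRHS]mulrC ler_wpM2l ?expR_ge0//.
  by rewrite (le_trans (hmul_le1 _ mY))// lerDl.
rewrite gtr0_norm// (le_trans (ler_wpM2l (expR_ge0 _) (hmul_le_mean (expR_gt0 u))))//.
rewrite mulrCA -expRN -expRD (_ : u / 2 + - u = - (2^-1 * u)); last by field.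
by rewrite ler_wpM2r ?expR_ge0// lerDr.
Qed.

Lemma measurable_hmul_expR : measurable_fun setT (fun u : R => expR (u / 2) * phi (expR u)).
Proof.
apply: measurable_funM; first by apply: measurableT_comp => //; exact: measurable_funM.
by apply: measurableT_comp; first exact: measurable_hmul.
Qed.

Lemma L1_hmul_expR : L1 (fun u => expR (u / 2) * phi (expR u)).
Proof.
have half0 : 0 < 2^-1 :> R by rewrite invr_gt0.
exact: (@L1_le _ _ _ mu _ _ measurable_hmul_expR hmul_expR_decay (L1_scale _ (L1_expN half0))).
Qed.

Lemma hmul_expR_le u : `|expR (u / 2) * phi (expR u)| <= 1 + mean.
Proof.
rewrite (le_trans (hmul_expR_decay u))// ler_piMr ?expR_le1 ?oppr_le0 ?mulr_ge0//.
by rewrite addr_ge0//; exact: Rintegral_ge0.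
Qed.

Lemma Rintegral_hmul_expR_neq0 : \int[mu]_u (expR (u / 2) * phi (expR u)) != 0.
Proof.
have iPhi := L1_hmul_expR.
apply/eqP => I0.
have : (\int[mu]_u `|(expR (u / 2) * phi (expR u))%:E| = 0)%E.
  under eq_integral do rewrite gee0_abs ?lee_fin ?mulr_ge0 ?expR_ge0 ?hmul_ge0//.
  by rewrite L1_EFin_Rintegral// I0.
have mE : measurable_fun setT (fun u : R => (expR (u / 2) * phi (expR u))%:E).
  by apply/measurable_EFinP; exact: measurable_hmul_expR.
move=> /(ae_eq_integral_abs mu measurableT mE) [N [mN N0 sN]].
have mean0 : 0 <= mean by exact: Rintegral_ge0.
have mean1 : 0 < mean + 1 by rewrite ltr_wpDl.
set u0 := ln (mean + 1).
have : (mu `]u0, (u0 + 1)%R]%classic <= mu N)%E.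
  apply: le_measure; rewrite ?inE//=.
  move=> u; rewrite /= in_itv/= => /andP[u0u _]; apply: sN => /(_ I) [] /eqP.
  rewrite mulf_eq0 gt_eqF ?expR_gt0//= gt_eqF// hmul_gt0//.
  by rewrite (@lt_trans _ _ (mean + 1)) ?ltrDl// -[ltLHS](@lnK _ (mean + 1)) ?posrE// ltr_expR.
rewrite N0 lebesgue_measure_itv/= lte_fin ltrDl ltr01 -EFinB addrAC subrr add0r.
by rewrite lee_fin ler10.
Qed.

End expected_fraction.

(** * Gamma mixtures *)

Section independence.
Context d (T : measurableType d) (R : realType) (P : probability T R).
Variables X Y : {RV P >-> R}.
Hypothesis XY : independent_RVs X Y.

(** Independence identifies the joint law of [X] and [Y] with the product of their laws. *)
Lemma ge0_integral_independent (f : R * R -> \bar R) :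
  measurable_fun setT f -> (forall z, 0 <= f z)%E ->
  (\int[P]_w f (X w, Y w) = \int[distribution P X]_x \int[P]_w f (x, Y w))%E.
Proof.
move=> mf f0; pose XYf w := (X w, Y w).
have mXY : measurable_fun setT XYf by exact: measurable_fun_pair.
transitivity (\int[pushforward P XYf]_z f z)%E.
  by rewrite ge0_integral_pushforward.
transitivity (\int[distribution P X \x distribution P Y]_z f z)%E.
  by apply: eq_measure_integral => A mA _; apply/esym; exact: product_measure_unique.
rewrite fubini_tonelli1//; apply: eq_integral => x _.
rewrite /fubini_F ge0_integral_distribution//.
exact: measurable_fun_pair2.
Qed.

End independence.

Section gamma_mixture.
Context d (T : measurableType d) (R : realType) (P : probability T R).
Notation mu := (@lebesgue_measure R).
Notation L1 f := (mu.-integrable setT (EFin \o f)).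
Variables X Y : {RV P >-> R}.
Hypothesis Y_gt0 : {ae P, forall w, 0 < Y w}.
Hypothesis Y_int : P.-integrable setT (EFin \o Y).
Variable k : nat.
Hypothesis X_gamma : gamma_distributed k X.
Hypothesis XY : independent_RVs X Y.

Definition gamma_cst (k : nat) : R := (Gamma_fun (k%:R : R))^-1.

Lemma gamma_cst_ge0 j : 0 <= gamma_cst j.
Proof.
by rewrite invr_ge0; apply: Rintegral_ge0 => x _; rewrite mulr_ge0 ?powR_ge0 ?expR_ge0.
Qed.

Lemma gamma_pdf_ge0 j (x : R) : 0 <= gamma_pdf j x.
Proof.
rewrite /gamma_pdf patchE; case: ifPn => //; rewrite inE/= in_itv/= andbT => x0.
by rewrite !mulr_ge0 ?gamma_cst_ge0 ?expR_ge0// exprn_ge0// ltW.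
Qed.

Lemma measurable_gamma_pdf j : measurable_fun setT (gamma_pdf j : R -> R).
Proof.
apply/(measurable_restrictT _ _).1 => //; apply: measurable_funTS.
apply: measurable_funM.
  by apply: measurable_funM => //; exact: measurable_funX.
by apply: measurableT_comp => //; exact: oppr_measurable.
Qed.

(** Otherwise the law of [X] would have total mass 0. *)
Lemma gamma_cst_neq0 : gamma_cst k != 0.
Proof.
apply/eqP => c0; have := X_gamma measurableT.
rewrite probability_setT integral0_eq; last first.
  move=> x _; rewrite /gamma_pdf patchE -/(gamma_cst k) c0.
  by case: ifPn => // _; rewrite !mul0r.
by move=> /eqP; rewrite eqe oner_eq0.
Qed.

Let mX : measurable_fun setT X. Proof. exact: measurable_funPT. Qed.
Let mY : measurable_fun setT Y. Proof. exact: measurable_funPT. Qed.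

Let phi := hmul P Y.
Let Phi (u : R) := expR (u / 2) * phi (expR u).
Let mean := \int[P]_w `|Y w|.

(** Condition on X = x. *)
Lemma hmul_gamma t : ((hmul P (fun w => Y w / X w) t)%:E =
  \int[mu]_x ((phi (x * t))%:E * (gamma_pdf k x)%:E))%E.
Proof.
have mdiv : measurable_fun setT (fun w => Y w / X w).
  by apply: measurable_funM => //; apply: measurableT_comp => //; exact: measurable_invr.
rewrite EFin_hmul//.
pose f (z : R * R) := (frac_part (z.2 / (z.1 * t)))%:E.
have mf : measurable_fun setT f.
  apply/measurable_EFinP; apply: measurableT_comp; first exact: measurable_frac_part.
  apply: measurable_funM; first exact: measurable_snd.
  by apply: measurableT_comp; [exact: measurable_invr|exact: measurable_funM].
have f0 z : (0 <= f z)%E by rewrite lee_fin frac_part_ge0.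
transitivity (\int[P]_w f (X w, Y w))%E.
  by apply: eq_integral => w _; rewrite /f/= invfM mulrA.
rewrite (ge0_integral_independent XY)//.
transitivity (\int[distribution P X]_x (phi (x * t))%:E)%E.
  by apply: eq_integral => x _; rewrite EFin_hmul.
have mphi : measurable_fun setT (fun x : R => (phi (x * t))%:E).
  apply/measurable_EFinP; apply: measurableT_comp; first exact: measurable_hmul.
  exact: mulrr_measurable.
have phi0 x : (0 <= (phi (x * t))%:E)%E by rewrite lee_fin hmul_ge0.
rewrite ge0_integral_distribution//.
have mX' : measurable_fun setT (X : T -> measurableTypeR R) by exact: mX.
transitivity (\int[pushforward P (X : T -> measurableTypeR R)]_x (phi (x * t)%R)%:E)%E.
  by rewrite ge0_integral_pushforward.
apply: (@ge0_integral_density _ (measurableTypeR R) R mu _ (gamma_pdf k) _ _ _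
  (fun x => (phi (x * t))%:E)) => //.
- exact: measurable_gamma_pdf.
- exact: gamma_pdf_ge0.
Qed.

(** Substitute x = e^v in the mixture at t = e^u: then phi is evaluated at e^(v + u), whence the
    correlation. *)
Lemma hmul_corr u : (0 < k)%N ->
  expR (u / 2) * hmul P (fun w => Y w / X w) (expR u) =
  gamma_cst k * corr (gamma_kernel k.-1 1) Phi u.
Proof.
move=> k0; pose K := expR (- (u / 2)) * gamma_cst k.
have iPhi : L1 Phi := L1_hmul_expR Y_gt0 Y_int.
have PhiM x : `|Phi x| <= 1 + mean := hmul_expR_le Y_gt0 Y_int x.
have iGP : L1 (fun v => gamma_kernel k.-1 1 v * Phi (v + u)) by exact: corr_L1r (L1_gamma_kernel _ ltr01) iPhi PhiM u.
suff -> : hmul P (fun w => Y w / X w) (expR u) = K * corr (gamma_kernel k.-1 1) Phi u.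
  by rewrite /K !mulrA -expRD subrr expR0 mul1r.
apply: EFin_inj; rewrite hmul_gamma /corr -RintegralZl// -L1_EFin_Rintegral; last exact: L1_scale.
transitivity (\int[mu]_(x in `]0%R, +oo[)
    ((phi (x * expR u))%:E * (gamma_pdf k x)%:E))%E.
  rewrite [RHS]integral_mkcond; apply: eq_integral => x _.
  rewrite [in RHS]patchE; case: ifPn => // x0.
  by rewrite /gamma_pdf patchE (negbTE x0) mule0.
rewrite ge0_integral_expR; last 2 first.
- apply: emeasurable_funM; apply/measurable_EFinP; last exact: measurable_gamma_pdf.
  apply: measurableT_comp; first exact: measurable_hmul.
  exact: mulrr_measurable.
- by move=> x; rewrite mule_ge0 ?lee_fin ?hmul_ge0 ?gamma_pdf_ge0.
apply: eq_integral => v _; rewrite -!EFinM; congr EFin.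
rewrite /gamma_pdf patchE mem_set/=; last by rewrite in_itv/= expR_gt0.
rewrite -/(gamma_cst k) /K /Phi /gamma_kernel mul1r mulrDl !expRD.
have E2 (x : R) : expR (x / 2) * expR (x / 2) = expR x by rewrite -expRD; congr expR; field.
rewrite -[X in _ * X = _](E2 v) (expRN (u / 2)); move: (expR_gt0 (u / 2)).
by move: (expR (u / 2)) (expR (- _)) (phi _) => a b c a0; field; rewrite gt_eqF.
Qed.

End gamma_mixture.

Section diagonal.
Context {R : realType} {U : Type}.

(** Approximations of each quality are eventually available.  For each n, choose one that has
    every quality 1 / j.+1 with j < n that is attained at all for this n. *)
Lemma diagonal_choice (E : nat -> U -> \bar R) (c0 : U) :
  (forall n c, 0 <= E n c)%E ->
  (forall e : R, 0 < e -> exists n, forall m, (n <= m)%N -> exists c, (E m c <= e%:E)%E) ->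
  exists c : nat -> U, (fun n => E n (c n)) @ \oo --> (0 : \bar R)%E.
Proof.
move=> E0 Ee; pose good m j c := (E m c <= (j.+1%:R^-1)%:E)%E.
have best m J : exists c, forall j, (j < J)%N -> (exists c', good m j c') -> good m j c.
  elim: J => [|J [c cJ]]; first by exists c0.
  have [[c' gc']|nc'] := pselect (exists c', good m J c').
    exists c' => j; rewrite ltnS => jJ _; apply: (le_trans gc').
    by rewrite lee_fin lef_pV2 ?posrE// ler_nat ltnS.
  exists c => j; rewrite ltnS leq_eqVlt => /predU1P[->|jJ]; last exact: cJ.
  by move=> ?.
have /choice[c cP] : forall m, exists c, forall j, (j < m)%N ->
  (exists c', good m j c') -> good m j c by move=> m; exact: best.
exists c.
have small (e : R) : 0 < e -> \forall n \near \oo, (E n (c n) <= e%:E)%E.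
  move=> e0; have [j _ /(_ j (leqnn j))/= je] : \forall j \near \oo, j.+1%:R^-1 < e.
    exact: near_infty_natSinv_lt (PosNum e0).
  have j0 : 0 < j.+1%:R^-1 :> R by rewrite invr_gt0.
  have [n nP] := Ee _ j0.
  exists (maxn n j.+1) => // m /=; rewrite geq_max => /andP[nm jm].
  by apply: le_trans (cP m j jm (nP m nm)) _; rewrite lee_fin ltW.
apply/fine_cvgP; split.
  apply: filterS (small 1 ltr01) => n En.
  by rewrite ge0_fin_numE// (le_lt_trans En)// ltry.
apply/cvgrPdist_le => e e0; apply: filterS (small e e0) => n En.
rewrite sub0r normrN ger0_norm ?fine_ge0// -lee_fin fineK//.
by rewrite ge0_fin_numE// (le_lt_trans En)// ltry.
Qed.

End diagonal.

(** * The theorem *)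

Lemma indic_target (R : realType) (u : R) : u != 0 ->
  expR (u / 2) * \1_(`]0, 1[ : set R) (expR u) = target u.
Proof.
move=> u0; rewrite targetE indicE; have [un|up|u_0] := ltrgtP u 0; last by rewrite u_0 eqxx in u0.
- by rewrite mem_set ?mulr1//= in_itv/= expR_gt0 expR_lt1.
- by rewrite memNset ?mulr0//= in_itv/= expR_gt0 expR_lt1/= ltNge (ltW up).
Qed.

Theorem theorem4 (R : realType) (d : measure_display) (T : measurableType d)
    (P : probability T R) (Y : {RV P >-> R}) (X : nat -> {RV P >-> R})
    (Y_gt0 : {ae P, forall w, 0 < Y w})
    (Y_int : P.-integrable setT (EFin \o Y))
    (X_gamma : forall k : nat, (1 <= k)%N -> gamma_distributed k (X k))
    (XY_indep : forall k : nat, (1 <= k)%N -> independent_RVs (X k) Y) :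
  gNB P (fun (k : nat) (w : T) => Y w / X k w).
Proof.
pose mu := @lebesgue_measure R.
pose Phi (u : R) := expR (u / 2) * hmul P Y (expR u).
pose h k t := hmul P (fun w => Y w / X k w) t.
have mY : measurable_fun setT Y by exact: measurable_funPT.
have mh k : measurable_fun setT (h k).
  apply: measurable_hmul; apply: measurable_funM => //.
  by apply: measurableT_comp; [exact: measurable_invr|exact: measurable_funPT].
pose err (n : nat) (c : nat -> R) (t : R) :=
  `| \1_(`]0, 1[ : set R) t - \sum_(1 <= k < n.+1) c k * h k t | ^+ 2.
have errE n c : (\int[mu]_(t in `]0%R, +oo[) (err n c t)%:E =
    \int[mu]_u (((target u - \sum_(i < n) (c i.+1 * gamma_cst R i.+1) * corr (gamma_kernel i 1) Phi u) ^+ 2)%:E))%E.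
  have merr : measurable_fun setT (fun t => (err n c t)%:E).
    apply/measurable_EFinP; apply: measurable_funX; apply: measurableT_comp => //.
    apply: measurable_funB; first by apply: measurable_indic; exact: measurable_itv.
    by apply: measurable_sum => k; exact: measurable_funM.
  rewrite ge0_integral_expR//; last by move=> t; rewrite lee_fin sqr_ge0.
  apply: ae_eq_integral => //.
  - apply: emeasurable_funM; last by apply/measurable_EFinP; exact: measurable_expR.
    exact: (measurableT_comp merr (@measurable_expR R)).
  - apply/measurable_EFinP; apply: measurable_funX; apply: measurable_funB.
      exact: L1_measurable L1_target.
    apply: measurable_sum => i; apply: measurable_funM => //.
    apply: (L1_measurable (mu := mu)).
    exact: (corr_L1 (L1_gamma_kernel i ltr01) (L1_hmul_expR Y_gt0 Y_int) (hmul_expR_le Y_gt0 Y_int)).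
  (* the two integrands may differ at u = 0, the image of t = 1 *)
  - exists [set 0]; split => //; first exact: lebesgue_measure_set1.
    move=> u /= nu; apply: contrapT => /eqP u0; apply: nu => _.
    rewrite -EFinM; congr EFin; rewrite /err real_normK ?num_real//.
    have E2 : expR u = expR (u / 2) ^+ 2 by rewrite expr2 -expRD; congr expR; field.
    rewrite [X in _ * X]E2 -exprMn mulrC mulrBr indic_target//; congr ((_ - _) ^+ 2).
    rewrite big_add1 big_mkord mulr_sumr; apply: eq_bigr => i _.
    rewrite mulrCA -mulrA; congr (_ * _).
    exact: (hmul_corr Y_gt0 Y_int (X_gamma i.+1 isT) (XY_indep i.+1 isT) u isT).
have approx (e : R) : 0 < e -> exists n, forall m, (n <= m)%N ->
    exists c, (\int[mu]_(t in `]0%R, +oo[) (err m c t)%:E <= e%:E)%E.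
  move=> e0.
  have [n [c [ir rle]]] := target_approximation (measurable_hmul_expR Y)
    (hmul_expR_decay Y_gt0 Y_int) (Rintegral_hmul_expR_neq0 Y_gt0 Y_int) e0.
  (* the constants of the densities are divided out, and missing coefficients are set to 0 *)
  exists n => m nm; exists (fun k => (k.-1 < n)%:R * c k.-1 / gamma_cst R k).
  rewrite errE; apply: (@le_trans _ _
      (\int[mu]_u ((target u - \sum_(i < n) c i * corr (gamma_kernel i 1) Phi u) ^+ 2)%:E)%E).
    rewrite le_eqVlt; apply/orP; left; apply/eqP/eq_integral => u _.
    congr ((_ - _) ^+ 2)%:E.
    rewrite [RHS](big_ord_widen _ (fun i => c i * corr (gamma_kernel i 1) Phi u) nm) [RHS]big_mkcond/=.
    apply: eq_bigr => i _; rewrite divfK ?(gamma_cst_neq0 (X_gamma i.+1 isT))//.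
    by case: ifP; rewrite ?mul1r ?mul0r.
  by rewrite L1_EFin_Rintegral// lee_fin.
have [|c cP] := diagonal_choice (fun=> 0) _ approx.
  by move=> n c; apply: integral_ge0 => t _; rewrite lee_fin sqr_ge0.
by exists (fun k n => c n k).
Qed.
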